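(* There is an algorithm with the following property. Let $p,q$ be primes with $q<p<2q$ and let $n=pq$. Let $e>1$ be an integer coprime with $\varphi(n)=(p-1)(q-1)$, and let $d=e^{-1}\pmod{\varphi(n)}$, so that $ed-k\varphi(n)=1$ for some integer $k$. Suppose $p+q-1=x+R$ with $x,R$ integers and $R>0$. If $$d<\left(\sqrt{2/3}\,n-\sqrt{3n}\right)(eR)^{-1/2},$$ then the algorithm, given as input only $n$, $e$ and $x$ (and not $p,q,d,k,R$), outputs the factors $p$ and $q$ in time polynomial in $\log(en)$.
   Context: $\varphi$ is Euler's totient function. The inverse $d=e^{-1}\pmod{\varphi(n)}$ is taken as the integer representative with $1\le d<\varphi(n)$. The number $x$ is the known part of $p+q-1$ (i.e. it is given to the algorithm) and $R$ is the unknown remainder. Running time is measured in bit operations. *)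

(* Defs.v *)
From mathcomp Require Import all_boot all_order all_algebra.

Set Implicit Arguments.
Unset Strict Implicit.
Unset Printing Implicit Defensive.

(* Running time in bit operations.  An algorithm is a structured program acting
   on registers, each of which is a stack of bits.  A program mentions only
   finitely many registers, and every step inspects or changes at most the top
   bit of one register, so a multitape Turing machine with one tape per register
   simulates it with constant overhead per step. *)

Inductive program : Type :=
  | Push of nat & bool
  | Pop of nat
  | Seq of program & program
  (* [Case i A B C] runs A if register i is empty, B if its top bit is 0 and
     C if its top bit is 1; the register is left unchanged. *)
  | Case of nat & program & program & program
  (* [While i A] repeats A as long as register i is nonempty. *)
  | While of nat & program.

Definition store : Type := nat -> seq bool.

Definition update (s : store) (i : nat) (v : seq bool) : store :=
  fun j => if j == i then v else s j.

(* What remains to be executed, in order, and the current registers.  The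
   length of the first component is bounded by the size of the program. *)
Definition configuration : Type := (seq program * store)%type.

Definition step (c : configuration) : configuration :=
  match c with
  | ([::], s) => ([::], s)
  | (Push i b :: k, s) => (k, update s i (b :: s i))
  | (Pop i :: k, s) => (k, update s i (behead (s i)))
  | (Seq A B :: k, s) => (A :: B :: k, s)
  | (Case i A B C :: k, s) =>
      ((if s i is b :: _ then if b then C else B else A) :: k, s)
  | (While i A :: k, s) =>
      (if s i is [::] then k else A :: While i A :: k, s)
  end.

Definition halts_with (A : program) (s0 : store) (t : nat) (s : store) : Prop :=
  iter t step ([:: A], s0) = ([::], s).

(* Binary digits, least significant bit on top, without leading zeros: the
   number of digits [up_log 2 n.+1] is the least l with n < 2 ^ l. *)
Definition bits (n : nat) : seq bool :=
  mkseq (fun i => odd (n %/ 2 ^ i)) (up_log 2 n.+1).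

(* The integer x is passed as its absolute value and a sign bit. *)
Definition input (n e : nat) (x : int) : store := fun i =>
  match i with
  | 0 => bits n
  | 1 => bits e
  | 2 => bits `|x|
  | 3 => [:: (x < 0)%R]
  | _ => [::]
  end.

(* Main.v *)
Require Import Defs.
From HB Require Import structures.
From mathcomp Require Import all_boot all_order all_algebra.
From mathcomp Require Import all_classical all_reals all_analysis.
From mathcomp Require Import zify lra.

(* Put N = n - x = phi(n) + R and r = k N - e d = k R - 1.  The bound on d, with
   2 (p + q)^2 <= 9 p q, gives 3 d r < 2 N, so that k/d approximates e/N from
   above up to 2 / (3 d^2).  Run the Euclidean algorithm on N and e: as long as
   (k, d) has not been reached, it is a positive combination of the two current
   cofactor vectors, and the approximation forces it to be either an upper
   convergent or, when the quotient is 2, the single intermediate fraction.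
   Only the remainder r and the cofactor k of a candidate are needed: they give
   R = (r + 1) / k, then p + q, then q by bisection.  The final product test
   makes wrong candidates harmless.

   All numbers are kept modulo 2 ^ W, where W is linear in the input length and
   large enough for every number that matters, and every loop runs exactly W
   times.  The running time is therefore polynomial in W whatever the values
   are, and correctness only concerns a function on tuples of numbers. *)

Set Implicit Arguments.
Unset Strict Implicit.
Unset Printing Implicit Defensive.

(** Legendre's criterion asks for an error below 1 / (2 d^2), whereas only 2 / (3 d^2) is available,
    so k/d may be missed by the convergents of e/N. What helps is the sign of the error: r >= 0 puts
    k/d above e/N, so a step that lowers the lower remainder can never pass it, and only a step on
    the upper remainder can. Passing it there implies an inequality that the constant 2/3 leaves
    satisfiable in a single way, which is why one extra candidate per round is enough. Positive
    coordinates of (k, d) with respect to two cofactor vectors replace the theory of continued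
    fractions: everything becomes arithmetic of natural numbers, and the same coordinates bound all
    cofactors by k < e, so that nothing wraps around before (k, d) is met. The length of x is not
    part of the time bound; the bound on d forces R < n, hence |x| <= n. *)

(** * Timed execution of stack programs *)

(** The continuation [k] is arbitrary and left intact, so that fragments compose; the exact time is
    hidden behind a bound because only upper estimates are ever added up. *)
Definition runs (A : program) (s : store) (b : nat) (s' : store) : Prop :=
  exists2 t, t <= b & forall k, iter t step (A :: k, s) = (k, s').

Lemma runs_leq A s b b' s' : b <= b' -> runs A s b s' -> runs A s b' s'.
Proof. by move=> lebb' [t let_ H]; exists t => //; apply: leq_trans lebb'. Qed.

Lemma runs_push i v s : runs (Push i v) s 1 (update s i (v :: s i)).
Proof. by exists 1. Qed.

Lemma runs_pop i s : runs (Pop i) s 1 (update s i (behead (s i))).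
Proof. by exists 1. Qed.

Lemma runs_seq A B s1 s2 s3 b1 b2 :
  runs A s1 b1 s2 -> runs B s2 b2 s3 -> runs (Seq A B) s1 (b1 + b2).+1 s3.
Proof.
move=> [t1 le1 H1] [t2 le2 H2]; exists (t2 + t1).+1; first by lia.
by move=> k; rewrite iterSr iterD H1 H2.
Qed.

Lemma runs_case i A B C s s' b :
  runs (if s i is v :: _ then if v then C else B else A) s b s' ->
  runs (Case i A B C) s b.+1 s'.
Proof.
by move=> [t le H]; exists t.+1 => // k; rewrite iterSr /= H.
Qed.

Lemma runs_while_nil i A s : s i = [::] -> runs (While i A) s 1 s.
Proof. by move=> si; exists 1 => // k /=; rewrite si. Qed.

Lemma runs_while_cons i A s1 s2 s3 b1 b2 :
  s1 i <> [::] -> runs A s1 b1 s2 -> runs (While i A) s2 b2 s3 ->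
  runs (While i A) s1 (b1 + b2).+1 s3.
Proof.
move=> si [t1 le1 H1] [t2 le2 H2]; exists (t2 + t1).+1; first by lia.
move=> k; rewrite iterSr iterD /=; case: (s1 i) si => // v l _.
by rewrite H1 H2.
Qed.

Ltac store_eq :=
  apply: funext => m; rewrite /update /=;
  repeat match goal with |- context [?a == ?b] => case: (a =P b) => ? end;
  subst; rewrite ?eqxx //=; try congruence; exfalso; lia.

Definition clear (i : nat) : program := While i (Pop i).

Lemma runs_clear i s : runs (clear i) s (2 * size (s i)).+1 (update s i [::]).
Proof.
move e: (s i) => l; elim: l s e => [|v l IH] s e.
  have -> : update s i [::] = s by store_eq.
  exact: runs_while_nil.
apply: (@runs_leq _ _ (1 + (2 * size l).+1).+1); first by rewrite /=; lia.
apply: runs_while_cons (runs_pop _ _) _; first by rewrite e.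
have -> : update s i [::] = update (update s i (behead (s i))) i [::].
  by store_eq.
by apply: IH; rewrite /update eqxx e.
Qed.

Definition move_bits (i j : nat) : program :=
  While i (Seq (Case i (Pop i) (Push j false) (Push j true)) (Pop i)).

Lemma runs_move i j s : i != j ->
  runs (move_bits i j) s (5 * size (s i)).+1
    (update (update s i [::]) j (catrev (s i) (s j))).
Proof.
move=> nij; move e: (s i) => l; elim: l s e => [|v l IH] s e.
  have -> : update (update s i [::]) j (catrev [::] (s j)) = s by store_eq.
  exact: runs_while_nil.
apply: (@runs_leq _ _ (4 + (5 * size l).+1).+1); first by rewrite /=; lia.
apply: (@runs_while_cons _ _ _ (update (update s j (v :: s j)) i l)).
- by rewrite e.
- apply: (@runs_leq _ _ (2 + 1).+1) => //.
  apply: (@runs_seq _ _ _ (update s j (v :: s j))).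
    by apply: runs_case; rewrite e; case: (v); apply: runs_push.
  have -> : update (update s j (v :: s j)) i l =
    update (update s j (v :: s j)) i (behead (update s j (v :: s j) i)).
    have -> : update s j (v :: s j) i = s i by rewrite /update (negbTE nij).
    by rewrite e.
  exact: runs_pop.
have -> : update (update s i [::]) j (catrev (v :: l) (s j)) =
   update (update (update (update s j (v :: s j)) i l) i [::]) j
     (catrev l (update (update s j (v :: s j)) i l j)).
  by store_eq.
by apply: IH; rewrite /update eqxx.
Qed.

(** Moving into [w] reverses the bits; unloading [w] reverses them back and restores register [i].
    This is why a copy takes a third, empty register. *)
Definition copy_bits (i j w : nat) : program :=
  Seq (move_bits i w)
    (While w (Seq (Case w (Pop w)
                     (Seq (Push i false) (Push j false))
                     (Seq (Push i true) (Push j true))) (Pop w))).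

Lemma runs_unload i j w s : i != j -> i != w -> j != w ->
  runs (While w (Seq (Case w (Pop w)
                     (Seq (Push i false) (Push j false))
                     (Seq (Push i true) (Push j true))) (Pop w)))
    s (7 * size (s w)).+1
    (update (update (update s w [::]) i (catrev (s w) (s i)))
       j (catrev (s w) (s j))).
Proof.
move=> nij niw njw; move e: (s w) => l; elim: l s e => [|v l IH] s e.
  have -> : update (update (update s w [::]) i (catrev [::] (s i))) j
    (catrev [::] (s j)) = s by store_eq.
  exact: runs_while_nil.
apply: (@runs_leq _ _ (6 + (7 * size l).+1).+1); first by rewrite /=; lia.
set s2 := update (update s i (v :: s i)) j (v :: s j).
apply: (@runs_while_cons _ _ _ (update s2 w l)).
- by rewrite e.
- apply: (@runs_leq _ _ (4 + 1).+1) => //.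
  apply: (@runs_seq _ _ _ s2).
    apply: runs_case; rewrite e.
    have H u : runs (Seq (Push i u) (Push j u)) s (1 + 1).+1
        (update (update s i (u :: s i)) j (u :: s j)).
      apply: runs_seq (runs_push _ _ _) _.
      have -> : s j = update s i (u :: s i) j.
        by rewrite /update eq_sym (negbTE nij).
      exact: runs_push.
    by rewrite /s2; case: (v); apply: H.
  have -> : update s2 w l = update s2 w (behead (s2 w)).
    suff -> : s2 w = v :: l by [].
    by rewrite /s2 /update !(eq_sym w) (negbTE niw) (negbTE njw) e.
  exact: runs_pop.
have -> : update (update (update s w [::]) i (catrev (v :: l) (s i))) j
    (catrev (v :: l) (s j)) =
  update (update (update (update s2 w l) w [::]) i
     (catrev l (update s2 w l i))) j (catrev l (update s2 w l j)).
  by rewrite /s2; store_eq.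
by apply: IH; rewrite /update eqxx.
Qed.

Lemma runs_copy i j w s : i != j -> i != w -> j != w -> s w = [::] ->
  runs (copy_bits i j w) s (12 * size (s i)).+3 (update s j (s i ++ s j)).
Proof.
move=> nij niw njw sw.
apply: (@runs_leq _ _ ((5 * size (s i)).+1 + (7 * size (s i)).+1).+1); first lia.
apply: runs_seq (runs_move _ niw) _.
set s2 := update _ w _.
have s2w : s2 w = rev (s i) by rewrite /s2 /update eqxx sw.
have -> : update s j (s i ++ s j) =
  update (update (update s2 w [::]) i (catrev (s2 w) (s2 i)))
       j (catrev (s2 w) (s2 j)).
  rewrite s2w !catrevE revK.
  have -> : s2 i = [::] by rewrite /s2 /update (negbTE niw) eqxx.
  have -> : s2 j = s j.
    by rewrite /s2 /update (negbTE njw) eq_sym (negbTE nij).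
  rewrite cats0 /s2; store_eq.
rewrite -(size_rev (s i)) -s2w; exact: runs_unload.
Qed.

(** * Fixed-width binary numbers *)

Fixpoint fw (W a : nat) : seq bool :=
  if W is W'.+1 then odd a :: fw W' a./2 else [::].

Fixpoint bval (l : seq bool) : nat := if l is b :: l' then b + (bval l').*2 else 0.

Lemma size_fw W a : size (fw W a) = W.
Proof. by elim: W a => //= W IH a; rewrite IH. Qed.

Lemma bval_lt l : bval l < 2 ^ size l.
Proof. by elim: l => //= b l; rewrite expnS; case: b; lia. Qed.

Lemma bval_fw W a : a < 2 ^ W -> bval (fw W a) = a.
Proof.
elim: W a => [|W IH] a /=; first by rewrite expn0; case: a.
rewrite expnS => lt; rewrite IH; last by lia.
by rewrite odd_double_half.
Qed.

Lemma fw_bval l : fw (size l) (bval l) = l.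
Proof.
elim: l => //= b l IH; rewrite half_bit_double IH.
by rewrite oddD odd_double addbF oddb.
Qed.

Lemma eq_fw l W a : size l = W -> bval l = a -> l = fw W a.
Proof. by move=> <- <-; rewrite fw_bval. Qed.

(** The carry out of a full adder. *)
Definition majb (a b c : bool) : bool := (a && b) || (c && (a || b)).

Fixpoint add_bits (c : bool) (l l' : seq bool) : seq bool :=
  match l, l' with
  | a :: k, b :: k' => (a (+) b (+) c) :: add_bits (majb a b c) k k'
  | _, _ => [::]
  end.

Fixpoint add_carry (c : bool) (l l' : seq bool) : bool :=
  match l, l' with
  | a :: k, b :: k' => add_carry (majb a b c) k k'
  | _, _ => c
  end.

Lemma size_add_bits c l l' : size l = size l' -> size (add_bits c l l') = size l.
Proof. by elim: l l' c => [|a l IH] [|b l'] c //= [/IH->]. Qed.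

Lemma bval_add c l l' : size l = size l' ->
  bval (add_bits c l l') + 2 ^ size l * add_carry c l l' = bval l + bval l' + c.
Proof.
elim: l l' c => [|a l IH] [|b l'] c //=; first by rewrite expn0 mul1n.
move=> [szl]; have := IH l' (majb a b c) szl; rewrite expnS; move: (add_carry _ _ _) => d.
case: a; case: b; case: c => /=; lia.
Qed.

(** Complementing the digits gives 2 ^ size - 1 - value, so an adder with complemented second
    operand and initial carry 1 subtracts. *)
Lemma bval_negb l : bval (map negb l) + bval l + 1 = 2 ^ size l.
Proof. by elim: l => //= b l; rewrite expnS; case: b => /=; lia. Qed.

(** * A ripple-carry adder on registers *)

Definition branch (r : nat) (f : bool -> program) : program :=
  Case r (f false) (f false) (f true).

Lemma runs_branch r f s b s' :
  runs (f (head false (s r))) s b s' -> runs (branch r f) s b.+1 s'.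
Proof. by move=> H; apply: runs_case; case: (s r) H => // v l; case: v. Qed.

(** Registers [b] and [b.+1] hold the operands and [b.+2] the carry; [b.+3] collects the sum digits,
    lowest first, hence in reverse order. *)
Definition adder_step (b : nat) (x y c : bool) : program :=
  Seq (Pop b) (Seq (Pop b.+1) (Seq (Pop b.+2)
    (Seq (Push b.+2 (majb x y c)) (Push b.+3 (x (+) y (+) c))))).

Lemma runs_adder_step b x y c s :
  runs (adder_step b x y c) s 9
    (update (update (update (update s b (behead (s b))) b.+1 (behead (s b.+1)))
       b.+2 (majb x y c :: behead (s b.+2)))
       b.+3 ((x (+) y (+) c) :: s b.+3)).
Proof.
apply: (@runs_leq _ _ (1 + (1 + (1 + (1 + 1).+1).+1).+1).+1) => //.
apply: runs_seq (runs_pop _ _) _.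
apply: runs_seq (runs_pop _ _) _.
apply: runs_seq (runs_pop _ _) _.
apply: runs_seq (runs_push _ _ _) _.
match goal with |- runs _ ?u _ ?v => have -> : v =
  update u b.+3 ((x (+) y (+) c) :: u b.+3) end; last exact: runs_push.
apply: funext => m; rewrite /update !eqxx.
have -> : (b.+1 == b) = false by lia.
have -> : (b.+2 == b) = false by lia.
have -> : (b.+2 == b.+1) = false by lia.
have -> : (b.+3 == b) = false by lia.
have -> : (b.+3 == b.+1) = false by lia.
have -> : (b.+3 == b.+2) = false by lia.
case: (m == b.+3) => //; case: (m =P b.+2) => //.
Qed.

Definition adder_loop (neg : bool) (b : nat) : program :=
  While b (branch b (fun x => branch b.+1 (fun y => branch b.+2 (fun c =>
    adder_step b x (neg (+) y) c)))).

Lemma runs_adder_loop neg b s l l' c : size l = size l' ->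
  s b = l -> s b.+1 = l' -> s b.+2 = [:: c] ->
  runs (adder_loop neg b) s (13 * size l).+1
    (update (update (update (update s b [::]) b.+1 [::])
       b.+2 [:: add_carry c l (map (addb neg) l')])
       b.+3 (catrev (add_bits c l (map (addb neg) l')) (s b.+3))).
Proof.
elim: l l' c s => [|x l IH] [|y l'] c s //=.
  move=> _ sb sb1 sb2.
  match goal with |- runs _ _ _ ?v => have -> : v = s end; first by store_eq.
  exact: runs_while_nil.
move=> [szl] sb sb1 sb2.
have H := @runs_adder_step b x (neg (+) y) c s.
match type of H with runs _ _ _ ?u => set s2 := u in H end.
apply: (@runs_leq _ _ (9.+3 + (13 * size l).+1).+1); first by lia.
apply: (@runs_while_cons _ _ _ s2); first by rewrite sb.
  apply: runs_branch; rewrite sb; apply: runs_branch; rewrite sb1.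
  by apply: runs_branch; rewrite sb2.
have E3 : s2 b.+3 = (x (+) (neg (+) y) (+) c) :: s b.+3.
  by rewrite /s2 /update eqxx.
have E2 : s2 b.+2 = [:: majb x (neg (+) y) c].
  rewrite /s2 /update eqxx sb2.
  by have -> : (b.+2 == b.+3) = false by lia.
have E1 : s2 b.+1 = l'.
  rewrite /s2 /update eqxx sb1.
  have -> : (b.+1 == b.+3) = false by lia.
  by have -> : (b.+1 == b.+2) = false by lia.
have E0 : s2 b = l.
  rewrite /s2 /update eqxx sb.
  have -> : (b == b.+3) = false by lia.
  have -> : (b == b.+2) = false by lia.
  by have -> : (b == b.+1) = false by lia.
have {H} := IH l' (majb x (neg (+) y) c) s2 szl E0 E1 E2.
rewrite E3; congr runs; rewrite /s2; store_eq.
Qed.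

(** Working on copies lets [i] and [j] coincide: a register added to itself is doubled, subtracted
    from itself it becomes zero. *)
Definition adder (neg : bool) (b i j : nat) : program :=
  Seq (copy_bits i b (b + 4)) (Seq (copy_bits j b.+1 (b + 4))
    (Seq (Push b.+2 neg) (adder_loop neg b))).

Definition free_from (b : nat) (s : store) : Prop := forall m, b <= m -> s m = [::].

Lemma runs_adder neg b i j s W :
  i < b -> j < b -> free_from b s -> size (s i) = W -> size (s j) = W ->
  runs (adder neg b i j) s (37 * W + 20)
    (update (update s b.+2 [:: add_carry neg (s i) (map (addb neg) (s j))])
       b.+3 (rev (add_bits neg (s i) (map (addb neg) (s j))))).
Proof.
move=> ib jb fs si sj.
apply: (@runs_leq _ _ ((12 * size (s i)).+3 + ((12 * size (s j)).+3
  + (1 + (13 * size (s i)).+1).+1).+1).+1); first by lia.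
apply: runs_seq.
  by apply: runs_copy; [lia|lia|lia|apply: fs; lia].
rewrite (fs b) // cats0.
set s1 := update s b (s i).
have s1j : s1 j = s j by rewrite /s1 /update; case: eqP => //; lia.
have s1b m : b < m -> s1 m = [::].
  by move=> ?; rewrite /s1 /update; case: eqP => [|_]; [lia|apply: fs; lia].
rewrite -{1}s1j.
apply: runs_seq.
  apply: runs_copy; [lia|lia|lia|apply: s1b; lia].
rewrite (s1b b.+1) // cats0 s1j.
set s2 := update s1 _ _.
apply: runs_seq; first exact: runs_push.
have -> : s2 b.+2 = [::].
  by rewrite /s2 /update; case: eqP => [|_]; [lia|apply: s1b].
set s3 := update s2 _ _.
have := @runs_adder_loop neg b s3 (s i) (s j) neg.
have -> : s3 b.+3 = [::].
  rewrite /s3 /update; case: eqP => [|_]; first lia.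
  rewrite /s2 /update; case: eqP => [|_]; first lia.
  rewrite /s1 /update; case: eqP => [|_]; first lia.
  by apply: fs; lia.
rewrite catrevE cats0 => H.
match goal with |- runs _ _ _ ?v =>
  match type of H with context [runs _ _ _ ?u] => have -> : v = u end end.
  apply: funext => m.
  have F : b <= m -> s m = [::] by apply: fs.
  rewrite /s3 /s2 /s1 /update.
  case: (m =P b.+3) => // n3; case: (m =P b.+2) => // n2.
  case: (m =P b.+1) => [e1|n1]; first by apply: F; lia.
  by case: (m =P b) => [e1|n0]; first by apply: F; lia.
apply: H; first by lia.
- rewrite /s3 /s2 /s1 /update eqxx.
  have -> : (b == b.+2) = false by lia.
  by have -> : (b == b.+1) = false by lia.
- rewrite /s3 /s2 /s1 /update eqxx.
  by have -> : (b.+1 == b.+2) = false by lia.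
- by rewrite /s3 /update eqxx.
Qed.

(** * Programs on numbers modulo a power of two *)

(** There are no constants: zero arises as the difference of a variable with itself, and one is a
    variable set beforehand. *)
Inductive cmd : Type :=
  | CCopy of nat & nat
  | CAdd of bool & nat & nat
  | CIf of nat & nat & cmd & cmd
  | CSeq of cmd & cmd
  | CLoop of cmd.

Definition upd (v : nat -> nat) (i a : nat) : nat -> nat :=
  fun j => if j == i then a else v j.

Fixpoint ev (W : nat) (c : cmd) (v : nat -> nat) : nat -> nat :=
  match c with
  | CCopy i j => upd v i (v j)
  | CAdd neg i j =>
      upd v i ((v i + (if neg then 2 ^ W - v j else v j)) %% 2 ^ W)
  | CIf i j A B => if v i <= v j then ev W A v else ev W B v
  | CSeq A B => ev W B (ev W A v)
  | CLoop A => iter W (ev W A) v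
  end.

Definition bounded (W : nat) (v : nat -> nat) : Prop := forall i, v i < 2 ^ W.

Lemma bounded_iter W f n v :
  (forall u, bounded W u -> bounded W (f u)) -> bounded W v ->
  bounded W (iter n f v).
Proof. by move=> Hf Hv; elim: n => //= n; apply: Hf. Qed.

Lemma bounded_ev W c v : bounded W v -> bounded W (ev W c v).
Proof.
elim: c v => [i j|neg i j|i j A IHA B IHB|A IHA B IHB|A IHA] v bv /=.
- by move=> m; rewrite /upd; case: eqP.
- by move=> m; rewrite /upd; case: eqP => // _; rewrite ltn_mod expn_gt0.
- by case: ifP => _; [apply: IHA|apply: IHB].
- by apply/IHB/IHA.
- exact: bounded_iter.
Qed.

(* Registers below [nv] hold the variables, register [nv] is a unary ruler of
   length W, and all registers from [b] on are free. *)
Fixpoint compile (nv b : nat) (c : cmd) : program :=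
  match c with
  | CCopy i j => Seq (clear i) (copy_bits j i b)
  | CAdd neg i j =>
      Seq (adder neg b i j) (Seq (Pop b.+2) (Seq (clear i) (move_bits b.+3 i)))
  | CIf i j A B =>
      Seq (adder true b j i) (Seq (clear b.+3)
        (Case b.+2 (Pop b.+2) (Seq (Pop b.+2) (compile nv b B))
           (Seq (Pop b.+2) (compile nv b A))))
  | CSeq A B => Seq (compile nv b A) (compile nv b B)
  | CLoop A =>
      Seq (copy_bits nv b b.+1) (While b (Seq (Pop b) (compile nv b.+1 A)))
  end.

Fixpoint wf (nv : nat) (c : cmd) : bool :=
  match c with
  | CCopy i j => [&& i < nv, j < nv & i != j]
  | CAdd _ i j => (i < nv) && (j < nv)
  | CIf i j A B => [&& i < nv, j < nv, wf nv A & wf nv B]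
  | CSeq A B => wf nv A && wf nv B
  | CLoop A => wf nv A
  end.

Fixpoint cost (W : nat) (c : cmd) : nat :=
  match c with
  | CCopy _ _ => 14 * W + 5
  | CAdd _ _ _ => 44 * W + 30
  | CIf _ _ A B => 39 * W + 30 + cost W A + cost W B
  | CSeq A B => (cost W A + cost W B).+1
  | CLoop A => W * (cost W A + 15) + 10
  end.

(** Powers of [W.+1] grow with the exponent even at W = 0. Degrees are added rather than maximised,
    since only the existence of a polynomial matters. *)
Lemma cost_poly c : exists C D, forall W, cost W c <= C * W.+1 ^ D.
Proof.
have mono x y z : y <= z -> forall W, x * W.+1 ^ y <= x * W.+1 ^ z.
  by move=> le W; rewrite leq_mul2l leq_pexp2l // orbT.
have merge C D C' D' W c1 c2 : c1 <= C * W.+1 ^ D -> c2 <= C' * W.+1 ^ D' ->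
    c1 + c2 <= (C + C') * W.+1 ^ (D + D').
  move=> le1 le2; rewrite mulnDl; apply: leq_add.
    by apply: leq_trans le1 _; apply: mono; lia.
  by apply: leq_trans le2 _; apply: mono; lia.
have lin a b W : a * W + b <= (a + b) * W.+1 ^ 1 by rewrite expn1; nia.
elim: c => [i j|neg i j|i j A [C [D IHA]] B [C' [D' IHB]]
  |A [C [D IHA]] B [C' [D' IHB]]|A [C [D IHA]]].
- by exists (14 + 5), 1 => W; apply: lin.
- by exists (44 + 30), 1 => W; apply: lin.
- exists (39 + 30 + C + C'), (1 + D + D') => W /=.
  exact: merge (merge _ _ _ _ _ _ _ (lin 39 30 W) (IHA W)) (IHB W).
- exists (0 + 1 + C + C'), (1 + D + D') => W /=.
  rewrite -add1n addnA.
  exact: merge (merge _ _ _ _ _ _ _ (lin 0 1 W) (IHA W)) (IHB W).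
- exists (C + (15 + 10)), (D + 1) => W /=; rewrite mulnDr -addnA.
  have -> : W * 15 = 15 * W by lia.
  rewrite mulnDl; apply: leq_add.
    by rewrite addn1 expnSr mulnA mulnC leq_mul.
  by apply: leq_trans (lin _ _ _) _; apply: mono; lia.
Qed.

Definition state (nv W : nat) (v : nat -> nat) (s : store) : store :=
  fun m => if m < nv then fw W (v m) else s m.

Lemma bval_negb_fw W a : a < 2 ^ W -> bval (map negb (fw W a)) = 2 ^ W - a - 1.
Proof.
move=> lt; have := bval_negb (fw W a); rewrite bval_fw // size_fw; lia.
Qed.

Lemma add_bits_fw W a b neg : a < 2 ^ W -> b < 2 ^ W ->
  add_bits neg (fw W a) (map (addb neg) (fw W b)) =
  fw W ((a + (if neg then 2 ^ W - b else b)) %% 2 ^ W).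
Proof.
move=> lta ltb.
have sz : size (fw W a) = size (map (addb neg) (fw W b)).
  by rewrite size_map !size_fw.
have szs : size (add_bits neg (fw W a) (map (addb neg) (fw W b))) = W.
  by rewrite size_add_bits // size_fw.
apply: eq_fw => //.
have := bval_add neg sz; have := bval_lt (add_bits neg (fw W a) (map (addb neg) (fw W b))).
rewrite szs size_fw bval_fw //.
have -> : bval (map (addb neg) (fw W b)) = if neg then 2 ^ W - b - 1 else b.
  case: neg {sz szs}; first exact: bval_negb_fw.
  rewrite (@eq_map _ _ (addb false) id) ?map_id ?bval_fw //; exact: addFb.
move: (bval (add_bits _ _ _)) => r ltr E.
have -> : a + (if neg then 2 ^ W - b else b) = add_carry neg (fw W a) (map (addb neg) (fw W b)) * 2 ^ W + r.
  by move: E; case: neg {sz szs} => /=; lia.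
by rewrite modnMDl modn_small.
Qed.

(** The carry out of b + (2 ^ W - 1 - a) + 1 is set exactly when b - a does not become negative;
    [CIf] compares in this way. *)
Lemma add_carry_fw W a b : a < 2 ^ W -> b < 2 ^ W ->
  add_carry true (fw W b) (map negb (fw W a)) = (a <= b).
Proof.
move=> lta ltb.
have sz : size (fw W b) = size (map negb (fw W a)).
  by rewrite size_map !size_fw.
have := bval_add true sz.
have := bval_lt (add_bits true (fw W b) (map negb (fw W a))).
rewrite size_add_bits // size_fw bval_negb_fw // bval_fw //.
case: add_carry => /=; lia.
Qed.

Lemma compile_runs nv W c b v s :
  wf nv c -> nv < b -> bounded W v -> free_from b s -> s nv = nseq W true ->
  runs (compile nv b c) (state nv W v s) (cost W c) (state nv W (ev W c v) s).
Proof.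
have statel u t m : m < nv -> state nv W u t m = fw W (u m).
  by rewrite /state => ->.
have freest u t b' : nv < b' -> free_from b' t -> free_from b' (state nv W u t).
  by move=> lt ft m le; rewrite /state; case: ltnP => [|_]; [lia|apply: ft].
elim: c b v s => [i j|neg i j|i j A IHA B IHB|A IHA B IHB|A IHA] b v s /=.
- move=> /and3P[ltin ltjn nij] nvb bv fs rs.
  apply: (@runs_leq _ _ ((2 * W).+1 + (12 * W).+3).+1); first by lia.
  apply: runs_seq.
    by have H := runs_clear i (state nv W v s); rewrite statel // size_fw in H; exact: H.
  set s1 := update _ _ _.
  have s1j : s1 j = fw W (v j).
    by rewrite /s1 /update eq_sym (negbTE nij) statel.
  have s1i : s1 i = [::] by rewrite /s1 /update eqxx.
  have s1b : s1 b = [::].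
    by rewrite /s1 /update; case: eqP => // _; apply: (freest v s b nvb fs).
  have := @runs_copy j i b s1; rewrite s1j s1i size_fw cats0 => H.
  have -> : state nv W (upd v i (v j)) s = update s1 i (fw W (v j)).
    apply: funext => m; rewrite /s1 /state /upd /update.
    by case: (m =P i) => // ->; rewrite ltin.
  by apply: H; [lia|lia|lia|].
- move=> /andP[ltin ltjn] nvb bv fs rs.
  apply: (@runs_leq _ _ (37 * W + 20 + (1 + ((2 * W).+1 + (5 * W).+1).+1).+1).+1).
    lia.
  apply: runs_seq.
    by apply: runs_adder; rewrite ?statel ?size_fw //; [lia|lia|apply: freest].
  rewrite !statel // add_bits_fw //; set r := (_ %% _); set c := add_carry _ _ _.
  apply: runs_seq; first exact: runs_pop.
  set s2 := update _ b.+2 _.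
  have s2i : s2 i = fw W (v i).
    rewrite /s2 /update.
    have -> : (i == b.+2) = false by lia.
    have -> : (i == b.+3) = false by lia.
    by rewrite statel.
  apply: runs_seq.
    by have H := runs_clear i s2; rewrite s2i size_fw in H; exact: H.
  set s3 := update s2 _ _.
  have s3b : s3 b.+3 = rev (fw W r).
    rewrite /s3 /s2 /update eqxx.
    have -> : (b.+3 == b.+2) = false by lia.
    have -> : (b.+3 == i) = false by lia.
    by rewrite eqxx.
  have nbi : b.+3 != i by lia.
  have := runs_move s3 nbi; rewrite s3b size_rev size_fw.
  have -> : s3 i = [::] by rewrite /s3 /update eqxx.
  rewrite catrevE cats0 revK; congr runs.
  apply: funext => m; rewrite /s3 /s2 /update /state /upd !eqxx.
  have fm : b <= m -> s m = [::] by apply: fs.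
  case: (m =P i) => [->|_]; first by rewrite ltin.
  case: (m =P b.+3) => [e|_]; first by case: ifP => [?|_]; [lia|rewrite fm //; lia].
  have -> : (b.+2 == b.+3) = false by lia.
  rewrite ?eqxx /=.
  by case: (m =P b.+2) => [e|_]; first by case: ifP => [?|_]; [lia|rewrite fm //; lia].
- move=> /and4P[ltin ltjn wA wB] nvb bv fs rs.
  apply: (@runs_leq _ _ (37 * W + 20 + ((2 * W).+1 +
     (1 + (cost W A + cost W B)).+2).+1).+1); first by lia.
  apply: runs_seq.
    by apply: runs_adder; rewrite ?statel ?size_fw //; [lia|lia|apply: freest].
  rewrite !statel //.
  have -> : add_carry true (fw W (v j)) [seq true (+) x | x <- fw W (v i)] = (v i <= v j).
    exact: add_carry_fw.
  set l := rev _; set s1 := update _ b.+3 _.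
  have s1b : s1 b.+3 = l by rewrite /s1 /update eqxx.
  apply: runs_seq.
    have H := runs_clear b.+3 s1; rewrite s1b /l size_rev size_add_bits in H.
      by rewrite size_fw in H; exact: H.
    by rewrite size_map !size_fw.
  set s2 := update s1 _ _; apply: runs_case.
  have s2b : s2 b.+2 = [:: v i <= v j].
    rewrite /s2 /s1 /update eqxx.
    by have -> : (b.+2 == b.+3) = false by lia.
  rewrite s2b.
  have E : update s2 b.+2 (behead (s2 b.+2)) = state nv W v s.
    rewrite s2b; apply: funext => m; rewrite /s2 /s1 /update /=.
    have fm : b <= m -> state nv W v s m = [::] by apply: freest.
    case: (m =P b.+2) => [e|_]; first by rewrite fm //; lia.
    by case: (m =P b.+3) => [e|_]; first by rewrite fm //; lia.
  have Hp : runs (Pop b.+2) s2 1 (state nv W v s).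
    by rewrite -E; apply: runs_pop.
  case: leqP => _.
    apply: (@runs_leq _ _ (1 + cost W A).+1); first lia.
    by apply: runs_seq Hp _; apply: IHA.
  apply: (@runs_leq _ _ (1 + cost W B).+1); first lia.
  by apply: runs_seq Hp _; apply: IHB.
- move=> /andP[wA wB] nvb bv fs rs; apply: runs_seq (IHA _ _ _ _ _ _ _ _) _ => //.
  by apply: IHB => //; apply: bounded_ev.
- move=> wA nvb bv fs rs.
  have stn u : state nv W u s nv = nseq W true by rewrite /state ltnn.
  apply: (@runs_leq _ _ ((12 * W).+3 + (W * (cost W A + 3)).+1).+1); first by lia.
  have Hc : runs (copy_bits nv b b.+1) (state nv W v s) (12 * W).+3
      (state nv W v (update s b (nseq W true))).
    have := @runs_copy nv b b.+1 (state nv W v s).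
    rewrite stn size_nseq (freest v s b nvb fs b (leqnn b)) cats0 => H.
    have -> : state nv W v (update s b (nseq W true)) =
      update (state nv W v s) b (nseq W true).
      apply: funext => m; rewrite /state /update.
      by case: (m =P b) => // ->; case: ltnP => //; lia.
    by apply: H; [lia|lia|lia|apply: (freest v s b nvb fs); lia].
  apply: runs_seq Hc _.
  (* The exit state is written with a unary counter equal to 0, to match the states met during the
     induction on the counter. *)
  have es : s = update s b (nseq 0 true).
    by apply: funext => m; rewrite /update; case: eqP => // ->; rewrite fs.
  rewrite [X in state _ _ (iter _ _ _) X]es.
  (* Only the occurrences of W that count iterations are generalised; those that give the width stay
     fixed. *)
  move: {3 4 7}W v bv => n; elim: n => [|n IHn] v bv.
    by apply: runs_while_nil; rewrite /state ltnNge ltnW //= /update eqxx.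
  apply: (@runs_leq _ _ ((1 + cost W A).+1 + (n * (cost W A + 3)).+1).+1).
    lia.
  apply: (@runs_while_cons _ _ _ (state nv W (ev W A v) (update s b (nseq n true)))).
  + by rewrite /state ltnNge ltnW //= /update eqxx.
  + apply: (@runs_seq _ _ _ (state nv W v (update s b (nseq n true)))).
      have := runs_pop b (state nv W v (update s b (nseq n.+1 true))).
      congr runs; apply: funext => m; rewrite /state /update eqxx.
      case: (m =P b) => [->|//]; case: ltnP => //; lia.
    apply: IHA => //; first lia.
      by move=> m le; rewrite /update; case: eqP => [|_]; [lia|apply: fs; lia].
    rewrite /update; case: eqP => //; lia.
  rewrite iterSr; apply: IHn; exact: bounded_ev.
Qed.

(** * Input and output *)

Lemma bval_cat l l' : bval (l ++ l') = bval l + 2 ^ size l * bval l'.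
Proof.
elim: l => [|b l IH] /=; first by rewrite expn0 mul1n.
by rewrite IH expnS; nia.
Qed.

Lemma bits_fw a : bits a = fw (up_log 2 a.+1) a.
Proof.
rewrite /bits; move: (up_log _ _) => l; elim: l a => // n IH c.
rewrite /mkseq /= -(addn0 1) iotaDl -map_comp expn0 divn1 -IH; congr (_ :: _).
by apply: eq_map => i /=; rewrite expnD expn1 divnMA divn2.
Qed.

Lemma bval_bits a : bval (bits a) = a.
Proof. by rewrite bits_fw bval_fw // up_logP. Qed.

Lemma size_bits a : size (bits a) = up_log 2 a.+1.
Proof. by rewrite bits_fw size_fw. Qed.

Lemma lt_size_bits a : a < 2 ^ size (bits a).
Proof. by rewrite -{1}(bval_bits a) bval_lt. Qed.

Lemma size_bits_leq a W : a < 2 ^ W -> size (bits a) <= W.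
Proof. by move=> lt; rewrite size_bits up_log_min. Qed.

(** The default [true] lets the empty list pass as having no leading zero, in agreement with
    [bits 0], which is empty. *)
Lemma canonical_bits l : last true l -> l = bits (bval l).
Proof.
move=> lastl; rewrite bits_fw.
suff <- : size l = up_log 2 (bval l).+1 by rewrite fw_bval.
case/lastP: l lastl => [|l b]; first by rewrite up_log1.
rewrite last_rcons => ->; rewrite size_rcons; apply/esym/up_log_eq => //.
rewrite -cats1 bval_cat /= muln1 expnS; have := bval_lt l; lia.
Qed.

(* [Pop i] is only reached with [i] empty, where it does nothing: this drops the
   leading zeros. *)
Definition strip (i w : nat) : program :=
  Seq (move_bits i w)
    (While w (Seq (Case w (Pop w) (Case i (Pop i) (Push i false) (Push i false))
       (Push i true)) (Pop w))).

Lemma runs_strip_loop i w s : i != w -> last true (s i) ->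
  runs (While w (Seq (Case w (Pop w) (Case i (Pop i) (Push i false) (Push i false))
       (Push i true)) (Pop w))) s (6 * size (s w)).+1
    (update (update s w [::]) i (bits (bval (catrev (s w) (s i))))).
Proof.
move=> niw; move e: (s w) => l; elim: l s e => [|v l IH] s e lasti.
  rewrite /= -canonical_bits //.
  have -> : update (update s w [::]) i (s i) = s by store_eq.
  exact: runs_while_nil.
apply: (@runs_leq _ _ (5 + (6 * size l).+1).+1); first by rewrite /=; lia.
pose r := if v || (s i != [::]) then v :: s i else [::].
have wi : (w == i) = false by rewrite eq_sym (negbTE niw).
apply: (@runs_while_cons _ _ _ (update (update s i r) w l)).
- by rewrite e.
- apply: (@runs_leq _ _ (3 + 1).+1) => //.
  apply: (@runs_seq _ _ _ (update s i r)).
    apply: runs_case; rewrite e /r; case: (v) => /=.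
      exact: runs_leq (runs_push _ _ _).
    apply: runs_case; case E: (s i) => [|u k] /=.
      have -> : [::] = behead (s i) by rewrite E.
      exact: runs_pop.
    rewrite -E; case: (u); exact: runs_push.
  have -> : l = behead (update s i r w) by rewrite /update wi e.
  exact: runs_pop.
set s2 := update (update s i r) w l.
have s2w : s2 w = l by rewrite /s2 /update eqxx.
have s2i : s2 i = r by rewrite /s2 /update (negbTE niw) eqxx.
have := IH s2 s2w; rewrite s2i.
have -> : bval (catrev (v :: l) (s i)) = bval (catrev l r).
  rewrite /= /r; case: ifP => //; case: (v) => //=; case: (s i) => // _.
  by rewrite !catrevE !bval_cat /= muln0.
have -> : update (update s2 w [::]) i (bits (bval (catrev l r))) =
  update (update s w [::]) i (bits (bval (catrev l r))) by rewrite {s2w s2i}/s2; store_eq.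
apply; rewrite /r; case: ifP => //=; case: (v) => //=.
by move: lasti; case: (s i).
Qed.

Lemma runs_strip i w s : i != w -> s w = [::] ->
  runs (strip i w) s (11 * size (s i)).+3 (update s i (bits (bval (s i)))).
Proof.
move=> niw sw.
apply: (@runs_leq _ _ ((5 * size (s i)).+1 + (6 * size (s i)).+1).+1); first lia.
apply: runs_seq (runs_move _ niw) _; rewrite sw catrevE cats0.
set s2 := update _ w _.
have s2w : s2 w = rev (s i) by rewrite /s2 /update eqxx.
have s2i : s2 i = [::] by rewrite /s2 /update eqxx (negbTE niw).
have := runs_strip_loop niw (s := s2); rewrite s2w s2i catrevE cats0 revK size_rev.
have -> : update (update s2 w [::]) i (bits (bval (s i))) =
   update s i (bits (bval (s i))).
  by rewrite {s2w s2i}/s2; store_eq.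
exact.
Qed.

(** The language has no empty program, so the base case already pushes one bit: the arguments 3 and
    7 stand for 4 and 8 ones. *)
Fixpoint push_ones (r k : nat) : program :=
  if k is k'.+1 then Seq (Push r true) (push_ones r k') else Push r true.

Lemma nseq_cat_cons (n : nat) (l : seq bool) :
  nseq n true ++ true :: l = nseq n.+1 true ++ l.
Proof. by elim: n => //= n ->. Qed.

Lemma runs_push_ones r k s :
  runs (push_ones r k) s (2 * k).+1 (update s r (nseq k.+1 true ++ s r)).
Proof.
elim: k s => [|k IH] s; first exact: runs_push.
apply: (@runs_leq _ _ (1 + (2 * k).+1).+1); first by lia.
apply: runs_seq (runs_push _ _ _) _.
set s2 := update _ _ _.
have s2r : s2 r = true :: s r by rewrite /s2 /update eqxx.
have -> : update s r (nseq k.+2 true ++ s r) =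
    update s2 r (nseq k.+1 true ++ s2 r).
  by rewrite s2r nseq_cat_cons {s2r}/s2; store_eq.
exact: IH.
Qed.

Definition grow (r i : nat) : program :=
  Seq (copy_bits i r.+1 r.+2)
    (While r.+1 (Seq (push_ones r 3) (Pop r.+1))).

Lemma runs_grow_loop r s :
  runs (While r.+1 (Seq (push_ones r 3) (Pop r.+1))) s (10 * size (s r.+1)).+1
    (update (update s r.+1 [::]) r (nseq (4 * size (s r.+1)) true ++ s r)).
Proof.
move e: (s r.+1) => l; elim: l s e => [|b l IH] s e.
  have -> : update (update s r.+1 [::]) r (nseq (4 * 0) true ++ s r) = s.
    by rewrite muln0; store_eq.
  exact: runs_while_nil.
apply: (@runs_leq _ _ ((7 + 1).+1 + (10 * size l).+1).+1); first by rewrite /=; lia.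
set s1 := update s r (nseq 4 true ++ s r).
have s1r : s1 r.+1 = b :: l.
  by rewrite /s1 /update; case: eqP => //; lia.
apply: (@runs_while_cons _ _ _ (update s1 r.+1 l)); first by rewrite e.
  apply: (@runs_seq _ _ _ s1); first exact: runs_push_ones.
  have -> : l = behead (s1 r.+1) by rewrite s1r.
  exact: runs_pop.
set s2 := update s1 _ _.
have s2r : s2 r.+1 = l by rewrite /s2 /update eqxx.
have := IH s2 s2r.
have -> : s2 r = nseq 4 true ++ s r.
  by rewrite /s2 /s1 /update eqxx; case: eqP => //; lia.
have -> : nseq (4 * size l) true ++ nseq 4 true ++ s r =
  nseq (4 * size (b :: l)) true ++ s r.
  by rewrite catA -nseqD [size (_ :: _)]/= mulnSr.
by congr runs; rewrite {s2r}/s2 {s1r}/s1; store_eq.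
Qed.

Lemma runs_grow r i s : i < r -> free_from r.+1 s ->
  runs (grow r i) s (22 * size (s i)).+4.+1
    (update s r (nseq (4 * size (s i)) true ++ s r)).
Proof.
move=> ir fs.
apply: (@runs_leq _ _ ((12 * size (s i)).+3 + (10 * size (s i)).+1).+1); first lia.
apply: runs_seq; first by apply: runs_copy; [lia|lia|lia|apply: fs; lia].
rewrite (fs r.+1) // cats0; set s2 := update _ _ _.
have s2r : s2 r.+1 = s i by rewrite /s2 /update eqxx.
have s2r' : s2 r = s r by rewrite /s2 /update; case: eqP => //; lia.
have := runs_grow_loop r s2; rewrite s2r s2r'; congr runs.
rewrite {s2r s2r'}/s2; apply: funext => m; rewrite /update.
by case: (m =P r) => // _; case: (m =P r.+1) => // ->; rewrite fs.
Qed.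

Definition pad (r i : nat) : program :=
  Seq (copy_bits r r.+1 r.+2)
   (Seq (While r.+1 (Seq (Case i (Push r.+2 false)
           (Seq (Pop i) (Push r.+2 false)) (Seq (Pop i) (Push r.+2 true)))
         (Pop r.+1)))
      (move_bits r.+2 i)).

Lemma runs_pad_loop r i s n : i < r -> s r.+1 = nseq n true ->
  runs (While r.+1 (Seq (Case i (Push r.+2 false)
           (Seq (Pop i) (Push r.+2 false)) (Seq (Pop i) (Push r.+2 true)))
         (Pop r.+1))) s (7 * n).+1
    (update (update (update s r.+1 [::]) i (drop n (s i)))
      r.+2 (catrev (fw n (bval (s i))) (s r.+2))).
Proof.
move=> ir; elim: n s => [|n IH] s sr.
  have -> : update (update (update s r.+1 [::]) i (drop 0 (s i)))
      r.+2 (catrev (fw 0 (bval (s i))) (s r.+2)) = s.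
    by rewrite drop0; store_eq.
  exact: runs_while_nil.
apply: (@runs_leq _ _ ((4 + 1).+1 + (7 * n).+1).+1); first lia.
set s1 := update (update s i (behead (s i))) r.+2 (head false (s i) :: s r.+2).
have s1r : s1 r.+1 = nseq n.+1 true.
  rewrite /s1 /update; case: eqP => [|_]; first lia.
  by case: eqP => //; lia.
apply: (@runs_while_cons _ _ _ (update s1 r.+1 (nseq n true))).
- by rewrite sr.
- apply: (@runs_seq _ _ _ s1).
    have H : runs (Seq (Pop i) (Push r.+2 (head false (s i)))) s (1 + 1).+1 s1.
      apply: runs_seq (runs_pop _ _) _.
      set u := update s i _; have ur : u r.+2 = s r.+2.
        by rewrite /u /update; case: eqP => //; lia.
      by rewrite /s1 -ur; apply: runs_push.
    apply: runs_case; case E: (s i) H => [|b l] //=; last by case: (b).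
    move=> _; apply: runs_leq (_ : runs _ _ 1 _) => //.
    have -> : s1 = update s r.+2 (false :: s r.+2).
      by rewrite {s1r}/s1 E; store_eq.
    exact: runs_push.
  have -> : nseq n true = behead (s1 r.+1) by rewrite s1r.
  exact: runs_pop.
set s2 := update s1 _ _.
have s2r : s2 r.+1 = nseq n true by rewrite /s2 /update eqxx.
have := IH s2 s2r.
have -> : s2 i = behead (s i).
  rewrite /s2 /s1 /update eqxx; case: eqP => [|_]; first lia.
  by case: eqP => //; lia.
have -> : s2 r.+2 = head false (s i) :: s r.+2.
  by rewrite /s2 /s1 /update eqxx; case: eqP => //; lia.
have -> : drop n (behead (s i)) = drop n.+1 (s i) by case: (s i).
have -> : catrev (fw n (bval (behead (s i)))) (head false (s i) :: s r.+2) =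
    catrev (fw n.+1 (bval (s i))) (s r.+2).
  case: (s i) => [|b l] //=.
  by rewrite half_bit_double oddD odd_double addbF oddb.
by congr runs; rewrite {s2r}/s2 {s1r}/s1; store_eq.
Qed.

Lemma runs_pad r i s W : i < r -> free_from r.+1 s -> s r = nseq W true ->
  size (s i) <= W ->
  runs (pad r i) s (24 * W + 10) (update s i (fw W (bval (s i)))).
Proof.
move=> ir fs sr sz.
apply: (@runs_leq _ _ ((12 * W).+3 + ((7 * W).+1 + (5 * W).+1).+1).+1); first lia.
apply: runs_seq.
  have := @runs_copy r r.+1 r.+2 s; rewrite sr size_nseq; apply; [lia|lia|lia|].
  by apply: fs; lia.
rewrite (fs r.+1) // cats0; set s1 := update _ _ _.
have s1r : s1 r.+1 = nseq W true by rewrite /s1 /update eqxx.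
apply: runs_seq (runs_pad_loop ir s1r) _.
have -> : s1 i = s i by rewrite /s1 /update; case: eqP => //; lia.
have -> : s1 r.+2 = [::].
  by rewrite /s1 /update; case: eqP => [|_]; [lia|apply: fs; lia].
rewrite drop_oversize // catrevE cats0; set s2 := update _ r.+2 _.
have s2r : s2 r.+2 = rev (fw W (bval (s i))) by rewrite /s2 /update eqxx.
have s2i : s2 i = [::].
  by rewrite /s2 /update eqxx; case: eqP => //; lia.
have nri : r.+2 != i by lia.
have := runs_move s2 nri; rewrite s2r s2i size_rev size_fw catrevE revK cats0.
congr runs; rewrite {s2r s2i}/s2 {s1r}/s1; apply: funext => m; rewrite /update.
case: (m =P i) => // _; case: (m =P r.+2) => [->|_]; first by rewrite fs.
by case: (m =P r.+1) => // ->; rewrite fs.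
Qed.

(** The base case pops a register that is empty, and so does nothing. *)
Fixpoint pad_all (r k : nat) : program :=
  if k is k'.+1 then Seq (pad_all r k') (pad r k') else Pop r.+1.

Lemma runs_pad_all r k s W : k <= r -> free_from r.+1 s -> s r = nseq W true ->
  (forall i, i < k -> size (s i) <= W) ->
  runs (pad_all r k) s (k * (24 * W + 11)).+1
    (state k W (fun i => bval (s i)) s).
Proof.
move=> + fs sr; elim: k => [|k IH] kr sz /=.
  have -> : state 0 W (fun i => bval (s i)) s = update s r.+1 (behead (s r.+1)).
    apply: funext => m; rewrite /state /update /=.
    by case: eqP => // ->; rewrite fs.
  exact: runs_pop.
apply: (@runs_leq _ _ ((k * (24 * W + 11)).+1 + (24 * W + 10)).+1); first lia.
apply: runs_seq; first by apply: IH => [|i ltik]; [lia|apply: sz; lia].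
set s2 := state _ _ _ _.
have s2k : s2 k = s k by rewrite /s2 /state ltnn.
have -> : state k.+1 W (fun i => bval (s i)) s = update s2 k (fw W (bval (s2 k))).
  rewrite s2k; apply: funext => m; rewrite /s2 /state /update.
  case: (m =P k) => [->|?]; first by rewrite ltnS leqnn.
  by have -> : (m < k.+1) = (m < k) by lia.
apply: runs_pad => //.
- by move=> m le; rewrite /s2 /state; case: ltnP => [|_]; [lia|apply: fs].
- by rewrite /s2 /state; case: ltnP => //; lia.
- by rewrite s2k; apply: sz.
Qed.

(** The constant one is pushed before the padding, so that it receives the common width as well. *)
Definition setup (nv : nat) : program :=
  Seq (push_ones nv 7) (Seq (grow nv 0) (Seq (grow nv 1)
    (Seq (Push 4 true) (pad_all nv nv)))).

Definition full_program (nv : nat) (c : cmd) : program :=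
  Seq (setup nv) (Seq (compile nv nv.+1 c)
    (Seq (strip 0 nv.+1) (strip 1 nv.+1))).

Lemma full_program_runs nv c s W : 4 < nv -> wf nv c -> free_from 4 s ->
  W = 4 * (size (s 0) + size (s 1)) + 8 -> (forall i, size (s i) <= W) ->
  exists v s', [/\ bounded W v, forall i, i < nv -> v i = if i == 4 then 1 else bval (s i),
    runs (full_program nv c) s
      (cost W c + (nv * (24 * W + 11) + (44 * W + 60))) s',
    s' 0 = bits (ev W c v 0) & s' 1 = bits (ev W c v 1)].
Proof.
move=> nv4 wfc fs eW szs.
pose s1 := update s nv (nseq W true).
pose s2 := update s1 4 [:: true].
pose v0 i := bval (s2 i).
have Hsetup : runs (setup nv) s (nv * (24 * W + 11) + (22 * W + 40)) (state nv W v0 s2).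
  apply: (@runs_leq _ _ ((2 * 7).+1 + ((22 * size (s 0)).+4.+1 +
    ((22 * size (s 1)).+4.+1 + (1 + (nv * (24 * W + 11)).+1).+1).+1).+1).+1).
    by lia.
  apply: runs_seq (runs_push_ones _ _ _) _; rewrite (fs nv) ?cats0; last lia.
  set t1 := update _ _ _.
  have t1E i : i != nv -> t1 i = s i by rewrite /t1 /update; case: eqP.
  have ft1 : free_from nv.+1 t1.
    by move=> m le; rewrite t1E; [apply: fs; lia|lia].
  apply: (@runs_seq _ _ _ (update s nv (nseq (4 * size (s 0) + 8) true))).
    have := @runs_grow nv 0 t1; rewrite t1E; last by lia.
    have -> : t1 nv = nseq 8 true by rewrite /t1 /update eqxx.
    rewrite -nseqD => H.
    have -> : update s nv (nseq (4 * size (s 0) + 8) true) =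
      update t1 nv (nseq (4 * size (s 0) + 8) true).
      by rewrite {t1E H ft1}/t1; store_eq.
    by apply: H; [lia|].
  set t2 := update _ _ _.
  have t2E i : i != nv -> t2 i = s i by rewrite /t2 /update; case: eqP.
  have ft2 : free_from nv.+1 t2.
    by move=> m le; rewrite t2E; [apply: fs; lia|lia].
  apply: (@runs_seq _ _ _ s1).
    have := @runs_grow nv 1 t2; rewrite t2E; last by lia.
    have -> : t2 nv = nseq (4 * size (s 0) + 8) true by rewrite /t2 /update eqxx.
    rewrite -nseqD => H.
    have -> : s1 = update t2 nv (nseq (4 * size (s 1) + (4 * size (s 0) + 8)) true).
      have -> : 4 * size (s 1) + (4 * size (s 0) + 8) = W by lia.
      by rewrite {t2E H ft2}/t2 /s1; store_eq.
    by apply: H; [lia|].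
  have s14 : s1 4 = [::].
    by rewrite /s1 /update; case: eqP => [|_]; [lia|apply: fs].
  have -> : state nv W v0 s2 = state nv W (fun i => bval (s2 i)) s2 by [].
  apply: (@runs_seq _ _ _ s2); first by rewrite /s2 -s14; apply: runs_push.
  apply: runs_pad_all => //.
  - move=> m le; rewrite /s2 /s1 /update; case: eqP => [|_]; first lia.
    by case: eqP => [|_]; [lia|apply: fs; lia].
  - by rewrite /s2 /s1 /update eqxx; case: eqP => //; lia.
  - move=> i lt; rewrite /s2 /s1 /update; case: eqP => [_|_]; first by rewrite /=; lia.
    by case: eqP => //; lia.
have s2nv : s2 nv = nseq W true.
  by rewrite /s2 /s1 /update eqxx; case: eqP => //; lia.
have fs2 : free_from nv.+1 s2.
  move=> m le; rewrite /s2 /s1 /update; case: eqP => [|_]; first lia.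
  by case: eqP => [|_]; [lia|apply: fs; lia].
have bv0 : bounded W v0.
  move=> i; rewrite /v0; apply: leq_trans (bval_lt _) _; rewrite leq_pexp2l //.
  rewrite /s2 /s1 /update; case: eqP => [_|_]; first by rewrite /=; lia.
  by case: eqP => [_|//]; rewrite size_nseq.
set s3 := state nv W (ev W c v0) s2.
have Hc : runs (compile nv nv.+1 c) (state nv W v0 s2) (cost W c) s3.
  by apply: compile_runs.
have bv3 : bounded W (ev W c v0) by apply: bounded_ev.
have fs3 : s3 nv.+1 = [::].
  by rewrite /s3 /state; case: ltnP => [|_]; [lia|apply: fs2].
have s3E i : i < nv -> s3 i = fw W (ev W c v0 i) by rewrite /s3 /state => ->.
have sb3 i : i < nv -> bval (s3 i) = ev W c v0 i by move=> /s3E ->; rewrite bval_fw.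
have ss3 i : i < nv -> size (s3 i) = W by move=> /s3E ->; rewrite size_fw.
set s4 := update s3 0 (bits (ev W c v0 0)).
have H0 : runs (strip 0 nv.+1) s3 (11 * W).+3 s4.
  by rewrite /s4 -(sb3 0) -1?(ss3 0) //; [apply: runs_strip|lia|lia].
set s5 := update s4 1 (bits (ev W c v0 1)).
have H1 : runs (strip 1 nv.+1) s4 (11 * W).+3 s5.
  have s41 : s4 1 = s3 1 by [].
  have s4n : s4 nv.+1 = [::] by [].
  have := @runs_strip 1 nv.+1 s4; rewrite s41 ss3 ?sb3; [|lia|lia].
  by move=> H; apply: H; [lia|exact: s4n].
exists v0, s5; split=> //.
- move=> i lt; rewrite /v0 /s2 /s1 /update; case: eqP => [|_] //.
  by case: eqP => //; lia.
- apply: runs_leq (runs_seq Hsetup (runs_seq Hc (runs_seq H0 H1))); lia.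
Qed.

(** * Arithmetic subroutines *)

Local Notation "A ;; B" := (CSeq A B) (at level 60, right associativity).

Fixpoint writes (c : cmd) : seq nat :=
  match c with
  | CCopy i _ | CAdd _ i _ => [:: i]
  | CIf _ _ A B | CSeq A B => writes A ++ writes B
  | CLoop A => writes A
  end.

Lemma ev_frame W c v i : i \notin writes c -> ev W c v i = v i.
Proof.
elim: c v => [j k|neg j k|j k A IHA B IHB|A IHA B IHB|A IHA] v /=.
- by rewrite inE /upd => /negbTE->.
- by rewrite inE /upd => /negbTE->.
- by rewrite mem_cat negb_or => /andP[/IHA HA /IHB HB]; case: ifP.
- by rewrite mem_cat negb_or => /andP[/IHA HA /IHB HB]; rewrite HB HA.
- move=> iA; suff H n : iter n (ev W A) v i = v i by apply: H.
  by elim: n => //= n IHn; rewrite IHA.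
Qed.

Lemma ev_seq W A B v : ev W (A ;; B) v = ev W B (ev W A v).
Proof. by []. Qed.

Lemma bounded_upd W v i a : bounded W v -> a < 2 ^ W -> bounded W (upd v i a).
Proof. by move=> bv lta j; rewrite /upd; case: eqP. Qed.

Lemma bounded_copy W v i j : bounded W v -> bounded W (upd v i (v j)).
Proof. by move=> bv; apply: bounded_upd. Qed.

Lemma bounded_upd0 W v i : bounded W v -> bounded W (upd v i 0).
Proof. by move=> bv; apply: bounded_upd; rewrite // expn_gt0. Qed.

Lemma bounded_upd_mod W v i a : bounded W v -> bounded W (upd v i (a %% 2 ^ W)).
Proof. by move=> bv; apply: bounded_upd; rewrite // ltn_mod expn_gt0. Qed.

Lemma ev_add W i j v :
  ev W (CAdd false i j) v = upd v i ((v i + v j) %% 2 ^ W).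
Proof. by []. Qed.

Lemma ev_sub W i j v : bounded W v -> v j <= v i ->
  ev W (CAdd true i j) v = upd v i (v i - v j).
Proof.
move=> bv le /=; congr upd; have := bv i; have := bv j => lj li.
have -> : v i + (2 ^ W - v j) = v i - v j + 2 ^ W by lia.
by rewrite modnDr modn_small //; lia.
Qed.

Lemma ev_if W i j A B v :
  ev W (CIf i j A B) v = if v i <= v j then ev W A v else ev W B v.
Proof. by []. Qed.

Lemma ev_loop W A v : ev W (CLoop A) v = iter W (ev W A) v.
Proof. by []. Qed.

Arguments ev : simpl never.

Local Hint Resolve bounded_copy bounded_upd0 bounded_upd_mod bounded_ev : core.

(* Variables 0 to 3 hold n, e, |x| and the sign of x, and [vOne] the constant 1.
   [(vR1, vK1)] and [(vR2, vK2)] are the upper and lower remainders with their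
   cofactors, [(vTR, vTK)] is the candidate to be tested, and [vP], [vO] receive
   p and q once they are found. *)
Local Notation vOne := 4 (only parsing).
Local Notation vA := 5 (only parsing).
Local Notation vB := 6 (only parsing).
Local Notation vQ := 7 (only parsing).
Local Notation vR := 8 (only parsing).
Local Notation vT := 9 (only parsing).
Local Notation vU := 10 (only parsing).
Local Notation vR1 := 11 (only parsing).
Local Notation vK1 := 12 (only parsing).
Local Notation vR2 := 13 (only parsing).
Local Notation vK2 := 14 (only parsing).
Local Notation vTR := 15 (only parsing).
Local Notation vTK := 16 (only parsing).
Local Notation vS := 17 (only parsing).
Local Notation vLo := 18 (only parsing).
Local Notation vHi := 19 (only parsing).
Local Notation vMid := 20 (only parsing).
Local Notation vN := 21 (only parsing).
Local Notation vP := 22 (only parsing).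
Local Notation vO := 23 (only parsing).
Local Notation vZ := 24 (only parsing).

(* Doubling modulo 2 ^ W decreases a number exactly when its top bit is set, so
   comparing [vT] with its double extracts the digits of [vT] from the top. *)
Definition mul_body : cmd :=
  CAdd false vQ vQ ;; CCopy vU vT ;; CAdd false vU vU ;;
  CIf vT vU (CCopy vT vU) (CAdd false vQ vA ;; CCopy vT vU).

Definition Mul : cmd :=
  CAdd true vQ vQ ;; CCopy vT vB ;; CLoop mul_body.

(* In the last line [CCopy vU vT] only serves to do nothing. *)
Definition div_body : cmd :=
  CAdd false vQ vQ ;; CAdd false vR vR ;; CCopy vU vT ;; CAdd false vU vU ;;
  CIf vT vU (CCopy vT vU) (CAdd false vR vOne ;; CCopy vT vU) ;;
  CIf vB vR (CAdd true vR vB ;; CAdd false vQ vOne) (CCopy vU vT).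

Definition Div : cmd :=
  CAdd true vQ vQ ;; CAdd true vR vR ;; CCopy vT vA ;; CLoop div_body.

Lemma top_bit W t : t < 2 ^ W -> (t <= (t + t) %% 2 ^ W) = (t + t < 2 ^ W).
Proof.
move=> lt; case: (ltnP (t + t)) => le; first by rewrite modn_small // leq_addr.
have -> : t + t = (t + t - 2 ^ W) + 2 ^ W by lia.
rewrite modnDr modn_small; lia.
Qed.

Lemma ev_zero W i v : bounded W v -> ev W (CAdd true i i) v = upd v i 0.
Proof. by move=> bv; rewrite ev_sub // subnn. Qed.

Lemma mul_bodyE W v : bounded W v ->
  let v' := ev W mul_body v in
  v' vT = (v vT + v vT) %% 2 ^ W /\
  v' vQ = (v vQ + v vQ + (2 ^ W <= v vT + v vT) * v vA) %% 2 ^ W.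
Proof.
move=> bv; rewrite /mul_body /ev /upd /= top_bit //.
by case: ltnP => le /=; split; rewrite // ?mul0n ?addn0 // mul1n modnDml.
Qed.

(** After i doublings the top bit of t is digit W - i - 1 of b, the next digit of the prefix read so
    far. Multiplication and division share this invariant, both consuming a number from its top. *)
Lemma top_digit W b i : i < W ->
  let t := (b * 2 ^ i) %% 2 ^ W in
  (t + t) %% 2 ^ W = (b * 2 ^ i.+1) %% 2 ^ W /\
  b %/ 2 ^ (W - i.+1) =
    b %/ 2 ^ (W - i) + b %/ 2 ^ (W - i) + (2 ^ W <= t + t).
Proof.
move=> lt t; split.
  by rewrite /t modnDm addnn -mul2n mulnCA -expnS.
have E1 : 2 ^ (W - i) = 2 * 2 ^ (W - i.+1) by rewrite -expnS; congr (2 ^ _); lia.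
have E2 : 2 ^ W = 2 ^ (W - i) * 2 ^ i by rewrite -expnD subnK // ltnW.
have Et : t = b %% 2 ^ (W - i) * 2 ^ i by rewrite /t E2 -muln_modl.
rewrite Et E2 -mulnDl leq_pmul2r ?expn_gt0 // E1.
set D := 2 ^ _; have D0 : 0 < D by rewrite expn_gt0.
have := ltn_pmod b (_ : 0 < 2 * D); rewrite muln_gt0 => /(_ D0).
have := divn_eq b (2 * D); set c := b %% _; set m := b %/ (2 * D) => eb ltc.
have -> : b = (m + m) * D + c by lia.
rewrite divnMDl //; congr addn; case: leqP => le.
  have -> : c = 1 * D + (c - D) by lia.
  by rewrite divnMDl // divn_small //; lia.
by rewrite divn_small //; lia.
Qed.

Lemma mul_spec W v : bounded W v -> ev W Mul v vQ = (v vA * v vB) %% 2 ^ W.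
Proof.
move=> bv.
rewrite /Mul ev_seq ev_zero // ev_seq; set u := ev W (CCopy _ _) _.
have bu : bounded W u by apply: bounded_copy; auto.
have H n : n <= W -> let w := iter n (ev W mul_body) u in
  [/\ w vT = (v vB * 2 ^ n) %% 2 ^ W, w vA = v vA &
      w vQ = (v vB %/ 2 ^ (W - n) * v vA) %% 2 ^ W].
  elim: n => [|n IH] /= le.
    by rewrite subn0 expn0 muln1 divn_small // mod0n modn_small.
  have [ET EA EQ] := IH (ltnW le).
  have bw : bounded W (iter n (ev W mul_body) u) by apply: bounded_iter => //; auto.
  have [E1 E2] := mul_bodyE bw.
  have [F1 F2] := top_digit (v vB) le.
  rewrite E1 E2 ev_frame // ET EA EQ F1; split=> //.
  by rewrite F2 [in RHS]mulnDl mulnDl -modnDml modnDm modnDml.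
rewrite ev_loop; have [_ _ ->] := H W (leqnn W).
by rewrite subnn expn0 divn1 mulnC.
Qed.

(** The divisor stays below half the modulus because the doubled partial remainder plus a digit can
    reach [2 * v vB - 1] and must not wrap around. The bounds by [2 ^ W.-1] further on come from
    here. *)
Lemma div_bodyE W v : bounded W v -> v vOne = 1 -> v vR < v vB ->
  v vB <= 2 ^ W.-1 -> v vQ + v vQ + 1 < 2 ^ W ->
  let v' := ev W div_body v in
  let r := v vR + v vR + (2 ^ W <= v vT + v vT) in
  [/\ v' vT = (v vT + v vT) %% 2 ^ W,
      v' vR = (if v vB <= r then r - v vB else r) &
      v' vQ = v vQ + v vQ + (v vB <= r)].
Proof.
move=> bv v1 ltR leB ltQ; rewrite /div_body !ev_seq.
have W0 : 0 < W by case: W ltQ {bv leB} => //; rewrite expn0; lia.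
have eW : 2 ^ W = 2 * 2 ^ W.-1 by rewrite -expnS prednK.
set w := ev W (CIf _ _ (CCopy _ _) _) _.
have hR : v vR + v vR + 1 < 2 ^ W by lia.
have [wT wU wR wB wQ] : [/\ w vT = (v vT + v vT) %% 2 ^ W,
    w vU = (v vT + v vT) %% 2 ^ W,
    w vR = v vR + v vR + (2 ^ W <= v vT + v vT), w vB = v vB &
    w vQ = v vQ + v vQ].
  have mR : (v vR + v vR) %% 2 ^ W = v vR + v vR by rewrite modn_small //; lia.
  have mQ : (v vQ + v vQ) %% 2 ^ W = v vQ + v vQ by rewrite modn_small //; lia.
  rewrite /w /ev /upd /= top_bit // mR mQ.
  case: ltnP => le /=; rewrite ?addn0 //.
  by rewrite v1 (modn_small hR).
have w1 : w vOne = 1 by rewrite /w ev_frame.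
have bw : bounded W w by rewrite /w; auto 10.
rewrite ev_if wB wR; case: leqP => le.
  rewrite ev_seq ev_sub //; last by rewrite wB wR.
  by rewrite ev_add /upd /= wR wB wT w1 wQ (modn_small ltQ).
by rewrite /ev /upd /= wR wT wQ addn0.
Qed.

Lemma ltn_double_exp2 W a : 0 < W -> a < 2 ^ W.-1 -> a + a + 1 < 2 ^ W.
Proof. by case: W => // W _ /=; rewrite expnS; lia. Qed.

Lemma divn_modn_double a d (t : bool) : 0 < d ->
  let r := a %% d + a %% d + t in
  (a + a + t) %/ d = a %/ d + a %/ d + (d <= r) /\
  (a + a + t) %% d = if d <= r then r - d else r.
Proof.
move=> d0 r; have := ltn_pmod a d0.
have -> : a + a + t = (a %/ d + a %/ d) * d + r.
  by rewrite /r {1 2}(divn_eq a d); lia.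
rewrite divnMDl // modnMDl /r; move: (a %/ d) (a %% d) => q c lt.
case: leqP => le; last by rewrite divn_small ?modn_small.
have e : c + c + t = 1 * d + (c + c + t - d) by lia.
have lt' : c + c + t - d < d by case: t {r} le e; lia.
move: (c + c + t - d) lt' e => r' lt' ->.
by rewrite divnMDl // modnMDl divn_small ?modn_small.
Qed.

Lemma div_spec W v : bounded W v -> v vOne = 1 -> 0 < v vB <= 2 ^ W.-1 ->
  ev W Div v vQ = v vA %/ v vB /\ ev W Div v vR = v vA %% v vB.
Proof.
move=> bv v1 /andP[B0 leB].
rewrite /Div ev_seq ev_zero // ev_seq ev_zero; last by auto.
rewrite ev_seq; set u := ev W (CCopy _ _) _.
have bu : bounded W u by apply: bounded_copy; auto.
have H n : n <= W -> let w := iter n (ev W div_body) u in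
  [/\ w vT = (v vA * 2 ^ n) %% 2 ^ W, w vB = v vB, w vOne = 1,
      w vQ = v vA %/ 2 ^ (W - n) %/ v vB &
      w vR = (v vA %/ 2 ^ (W - n)) %% v vB].
  elim: n => [|n IH] /= le.
    by rewrite subn0 expn0 muln1 (divn_small (bv vA)) (modn_small (bv vA)) div0n mod0n.
  have [ET EB E1 EQ ER] := IH (ltnW le).
  set w := iter _ _ _ in ET EB E1 EQ ER *.
  have bw : bounded W w by apply: bounded_iter => //; auto.
  have [F1 F2] := top_digit (v vA) le.
  have hQ : w vQ + w vQ + 1 < 2 ^ W.
    apply: ltn_double_exp2; first exact: leq_ltn_trans le.
    rewrite EQ; apply: leq_ltn_trans (leq_div _ _) _.
    rewrite ltn_divLR ?expn_gt0 // -expnD; apply: leq_trans (bv vA) _.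
    by rewrite leq_pexp2l //; move: le {F1 F2 ET EQ ER}; lia.
  have hR : w vR < w vB by rewrite ER EB ltn_mod.
  have hB : w vB <= 2 ^ W.-1 by rewrite EB.
  have [G1 G2 G3] := div_bodyE bw E1 hR hB hQ.
  have [H1 H2] := divn_modn_double (v vA %/ 2 ^ (W - n))
    (2 ^ W <= w vT + w vT) B0.
  rewrite -ET in F1 F2; rewrite G1 G2 G3 !ev_frame // EB E1 F1 F2 H1 H2 ER EQ.
  by [].
rewrite ev_loop; have [_ _ _ -> ->] := H W (leqnn W).
by rewrite subnn expn0 divn1.
Qed.

(** Seeks q as the smaller root of m (s - m) = n, avoiding a square root. The 0 in [CIf vQ 0] is the
    variable that holds n. *)
Definition Bisect_body : cmd :=
  CCopy vA vLo ;; CAdd false vA vHi ;; CCopy vB vOne ;; CAdd false vB vOne ;;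
  Div ;; CCopy vMid vQ ;; CCopy vA vMid ;; CCopy vB vS ;; CAdd true vB vMid ;;
  Mul ;; CIf vQ 0 (CCopy vLo vMid) (CCopy vHi vMid).

Lemma modn_sub W a b : b <= a < 2 ^ W -> (a + (2 ^ W - b)) %% 2 ^ W = a - b.
Proof.
move=> /andP[le lt]; have -> : a + (2 ^ W - b) = a - b + 2 ^ W by lia.
by rewrite modnDr modn_small //; lia.
Qed.

Lemma bisect_bodyE W v : 2 < W -> bounded W v -> v vOne = 1 ->
  v vLo + v vHi < 2 ^ W ->
  let mid := (v vLo + v vHi) %/ 2 in
  mid <= v vS -> mid * (v vS - mid) < 2 ^ W ->
  let v' := ev W Bisect_body v in
  let P := mid * (v vS - mid) <= v 0 in
  v' vLo = (if P then mid else v vLo) /\ v' vHi = (if P then v vHi else mid).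
Proof.
move=> W1 bv v1 lt2 mid lemid ltP.
have le2 : 2 ^ 2 <= 2 ^ W.-1 by rewrite leq_exp2l //; lia.
have lt2' : (1 + 1) %% 2 ^ W = 2.
  by rewrite modn_small //; apply: leq_trans (_ : 2 ^ 2 <= _); rewrite ?leq_exp2l //; lia.
rewrite /Bisect_body 4!ev_seq; set u1 := ev W (CAdd false vB vOne) _.
have b1 : bounded W u1 by rewrite /u1; auto 10.
have [u1A u1B] : u1 vA = v vLo + v vHi /\ u1 vB = 2.
  by rewrite /u1 /ev /upd /= v1 modn_small.
have u1E i : i \notin [:: vA; vB] -> u1 i = v i.
  by rewrite !inE !negb_or => /andP[/negbTE h1 /negbTE h2]; rewrite /u1 /ev /upd /= h1 h2.
have hB : 0 < u1 vB <= 2 ^ W.-1 by rewrite u1B; apply: leq_trans le2.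
have u11 : u1 vOne = 1 by rewrite u1E.
have [] := div_spec b1 u11 hB; rewrite u1A u1B -/mid => D _.
rewrite ev_seq; set u2 := ev W Div u1 in D *.
have b2 : bounded W u2 by rewrite /u2; auto.
have u2E i : i \notin writes Div ++ [:: vA; vB] -> u2 i = v i.
  by rewrite mem_cat negb_or => /andP[h1 h2]; rewrite /u2 ev_frame ?u1E.
rewrite 4!ev_seq; set u3 := ev W (CAdd true vB vMid) _.
have b3 : bounded W u3 by rewrite /u3; auto 10.
have [u3A u3B u3M] : [/\ u3 vA = mid, u3 vB = v vS - mid & u3 vMid = mid].
  by rewrite /u3 /ev /upd /= D u2E // modn_sub // lemid /=.
have u3E i : i \notin [:: vA; vB; vMid] -> u3 i = u2 i.
  rewrite !inE !negb_or => /and3P[/negbTE h1 /negbTE h2 /negbTE h3].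
  by rewrite /u3 /ev /upd /= h1 h2 h3.
rewrite ev_seq; have := mul_spec b3; rewrite u3A u3B modn_small // => M.
set u4 := ev W Mul u3 in M *.
have u4E i : i \in [:: 0; vLo; vHi] -> u4 i = v i.
  by rewrite !inE => /or3P[] /eqP ->; rewrite /u4 ev_frame // u3E // u2E.
have u4M : u4 vMid = mid by rewrite /u4 ev_frame.
by rewrite ev_if M u4E //; case: ifP => _; rewrite /ev /upd /= u4M u4E.
Qed.

(* The difference of the two sides is [(p - m) * (q - m)]. *)
Lemma leq_mul_root p q m : q < p -> m < p ->
  (m * (p + q - m) <= p * q) = (m <= q).
Proof.
move=> qp mp; case: (leqP m q) => [mq|qm].
  have {}mq : q = m + (q - m) by lia.
  have {}mp : p = m + (p - m) by lia.
  move: (q - m) (p - m) mq mp => a b -> ->.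
  have -> : m + b + (m + a) - m = m + a + b by lia.
  by apply/eqP; nia.
have {}qp : m = q + (m - q) by lia.
have {}mp' : p = m + (p - m) by lia.
have a0 : 0 < m - q by lia.
have b0 : 0 < p - m by lia.
move: (m - q) (p - m) a0 b0 qp mp' {mp qm} => a b a0 b0 -> ->.
have -> : q + a + b + q - (q + a) = q + b by lia.
have : 0 < a * b by rewrite muln_gt0 a0.
by move=> ?; apply/negbTE; rewrite -ltnNge; nia.
Qed.

(** The initial upper end exceeds q and is at most p, which keeps all midpoints below the larger
    root. The quantity hi - lo - 1 is at least halved each time, so W rounds bring it to 0; further
    rounds change nothing. *)
Lemma bisect_spec W v p q : 2 < W -> bounded W v -> v vOne = 1 ->
  1 < q < p -> v 0 = p * q -> v vS = p + q -> (p + q) * (p + q) < 2 ^ W ->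
  v vLo = 0 -> v vHi = (p + q) %/ 2 + 1 ->
  ev W (CLoop Bisect_body) v vLo = q.
Proof.
move=> W2 bv v1 /andP[q1 qp] vn vs lts vlo vhi; rewrite ev_loop.
have H i : let w := iter i (ev W Bisect_body) v in
  [/\ bounded W w, [/\ w vOne = 1, w 0 = p * q & w vS = p + q],
      w vLo <= q < w vHi, w vHi <= p & (w vHi - w vLo - 1) * 2 ^ i < 2 ^ W].
  elim: i => [|i] /=.
    split => //; first by rewrite vlo vhi; lia.
      by rewrite vhi; lia.
    by rewrite vlo vhi expn0; nia.
  set w := iter _ _ _ => -[bw [w1 wn ws] /andP[loq qhi] hip gap].
  have h1 : w vLo + w vHi < 2 ^ W by apply: leq_ltn_trans lts; nia.
  have h2 : (w vLo + w vHi) %/ 2 <= w vS by rewrite ws; lia.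
  have h3 : (w vLo + w vHi) %/ 2 * (w vS - (w vLo + w vHi) %/ 2) < 2 ^ W.
    by apply: leq_ltn_trans lts; rewrite leq_mul ?ws //; lia.
  have [] := bisect_bodyE W2 bw w1 h1 h2 h3; rewrite ws wn.
  have : (w vLo + w vHi) %/ 2 < w vHi by lia.
  have : w vLo <= (w vLo + w vHi) %/ 2 by lia.
  have : w vHi - (w vLo + w vHi) %/ 2 - 1 <= (w vHi - w vLo - 1) %/ 2 by lia.
  have : (w vLo + w vHi) %/ 2 - w vLo - 1 <= (w vHi - w vLo - 1) %/ 2 by lia.
  have : (w vHi - w vLo - 1) %/ 2 * 2 ^ i.+1 < 2 ^ W.
    apply: leq_ltn_trans gap; rewrite expnS mulnA leq_mul2r leq_trunc_div orbT //.
  move: (_ %/ 2) => g; move: (_ %/ 2) => m lg g1 g2 lm mh.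
  have -> : (m * (p + q - m) <= p * q) = (m <= q).
    by apply: leq_mul_root => //; apply: leq_trans hip.
  move=> Elo Ehi; rewrite Elo Ehi !ev_frame //; split=> //; try by auto.
  - by case: (leqP m q) => ?; apply/andP; split => //; lia.
  - by case: (leqP m q) => ?; lia.
  - apply: leq_ltn_trans lg; rewrite leq_mul2r.
    by case: (leqP m q) => ?; [rewrite g2|rewrite g1]; rewrite orbT.
have [_ _ /andP[lo hi] _] := H W.
rewrite -{2}[2 ^ W]mul1n ltn_pmul2r ?expn_gt0 //; lia.
Qed.

(* [vS] receives p + q = n + 1 - N + R with R = (r + 1) / k. *)
Definition Sum : cmd :=
  CCopy vA vTR ;; CAdd false vA vOne ;; CCopy vB vTK ;; Div ;;
  CCopy vS 0 ;; CAdd false vS vOne ;; CAdd true vS vN ;; CAdd false vS vQ ;;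
  CCopy vA vS ;; CCopy vB vOne ;; CAdd false vB vOne ;; Div ;;
  CCopy vHi vQ ;; CAdd false vHi vOne ;; CAdd true vLo vLo.

Lemma sum_spec W v R s : 2 < W -> bounded W v -> v vOne = 1 ->
  0 < v vTK <= 2 ^ W.-1 -> v vTR + 1 = v vTK * R -> v vTR + 1 < 2 ^ W ->
  v 0 + 1 + R = s + v vN -> s + 1 < 2 ^ W ->
  let v' := ev W Sum v in
  [/\ v' vS = s, v' vLo = 0 & v' vHi = s %/ 2 + 1].
Proof.
move=> W2 bv v1 hk hR lt1 hs lts.
have le2 : 2 ^ 2 <= 2 ^ W.-1 by rewrite leq_exp2l //; lia.
have lt2' : (1 + 1) %% 2 ^ W = 2.
  by rewrite modn_small //; apply: leq_trans (_ : 2 ^ 2 <= _); rewrite ?leq_exp2l //; lia.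
rewrite /Sum 3!ev_seq; set u1 := ev W (CCopy vB vTK) _.
have b1 : bounded W u1 by rewrite /u1; auto 10.
have [u1A u1B u11] : [/\ u1 vA = v vTR + 1, u1 vB = v vTK & u1 vOne = 1].
  by rewrite /u1 /ev /upd /= v1 modn_small.
have hB : 0 < u1 vB <= 2 ^ W.-1 by rewrite u1B.
have [] := div_spec b1 u11 hB; rewrite u1A u1B hR => D _.
move: D; rewrite mulKn; last by case/andP: hk.
rewrite ev_seq; set u2 := ev W Div u1 => D.
have b2 : bounded W u2 by rewrite /u2; auto.
have u2E i : i \in [:: 0; vOne; vN] -> u2 i = v i.
  by rewrite !inE => /or3P[] /eqP ->; rewrite /u2 ev_frame.
rewrite 7!ev_seq; set u3 := ev W (CAdd false vB vOne) _.
have b3 : bounded W u3 by rewrite /u3; auto 10.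
(* In the intended use n + 1 - N = p + q - R, which is negative for large R; the wrap-around is
   undone when R is added. *)
have Es : (((v 0 + 1) %% 2 ^ W + (2 ^ W - v vN)) %% 2 ^ W + R) %% 2 ^ W = s.
  rewrite modnDml -addnA modnDml.
  have -> : v 0 + 1 + (2 ^ W - v vN + R) = s + 2 ^ W.
    by have := bv vN; lia.
  by rewrite modnDr modn_small //; lia.
have [u3A u3B u31 u3S] : [/\ u3 vA = s, u3 vB = 2, u3 vOne = 1 & u3 vS = s].
  by rewrite /u3 /ev /upd /= D !u2E // v1 Es lt2'.
rewrite ev_seq.
have hB3 : 0 < u3 vB <= 2 ^ W.-1 by rewrite u3B; apply: leq_trans le2.
have [] := div_spec b3 u31 hB3; rewrite u3A u3B => D3 _.
set u4 := ev W Div u3 in D3 *.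
have b4 : bounded W u4 by rewrite /u4; auto.
have [u4S u41] : u4 vS = s /\ u4 vOne = 1 by rewrite /u4 !ev_frame.
rewrite 2!ev_seq ev_zero; last by auto.
rewrite /ev /upd /= u4S u41 D3 modn_small //.
by apply: leq_ltn_trans lts; rewrite leq_add2r leq_div.
Qed.

(* [CCopy vA vB] only serves to do nothing. *)
Definition Check : cmd :=
  CCopy vZ vS ;; CAdd true vZ vLo ;; CCopy vA vLo ;; CCopy vB vZ ;; Mul ;;
  CIf vQ 0 (CIf 0 vQ (CIf vLo vZ
    (CIf 0 vZ (CCopy vA vB) (CCopy vP vZ ;; CCopy vO vLo))
    (CCopy vA vB)) (CCopy vA vB)) (CCopy vA vB).

Definition found (p q : nat) (v : nat -> nat) : Prop := v vP = p /\ v vO = q.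

(** The bound [z < p * q] excludes the trivial factorisation and [y <= z] the swapped one, so a
    product that passes the test yields p and q wherever it came from. *)
Lemma semiprime_factors p q y z : prime p -> prime q -> q < p ->
  y <= z < p * q -> y * z = p * q -> y = q /\ z = p.
Proof.
move=> pp pq qp /andP[yz zn] e.
have p1 := prime_gt1 pp; have q1 := prime_gt1 pq.
have : p %| y * z by rewrite e dvdn_mulr.
rewrite Euclid_dvdM // => /orP[/dvdnP[c ec]|/dvdnP[c ec]]; last first.
  have eq : y * c = q.
    by apply/eqP; rewrite -(@eqn_pmul2r p) ?prime_gt0 // -mulnA -ec e mulnC.
  have : y %| q by rewrite -eq dvdn_mulr.
  move: pq => /primeP[_ H] /H /orP[/eqP y1|/eqP yq].
    by move: zn e; rewrite y1 mul1n => + e; rewrite e ltnn.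
  split=> //; apply/eqP; move: e => /eqP.
  by rewrite yq mulnC eqn_pmul2r // ltnW.
have eq : c * z = q.
  by apply/eqP; rewrite -(@eqn_pmul2l p) ?prime_gt0 // mulnA [p * c]mulnC -ec e.
by exfalso; have c0 : 0 < c by [case: c ec eq => //; nia]; nia.
Qed.

Lemma checkE W v : bounded W v ->
  let v' := ev W Check v in
  let z := (v vS + (2 ^ W - v vLo)) %% 2 ^ W in
  if [&& (v vLo * z) %% 2 ^ W == v 0, v vLo <= z & z < v 0]
  then v' vP = z /\ v' vO = v vLo else v' vP = v vP /\ v' vO = v vO.
Proof.
move=> bv v' z; rewrite {}/v' /Check 4!ev_seq; set u1 := ev W (CCopy vB vZ) _.
have b1 : bounded W u1 by rewrite /u1; auto 10.
have [u1A u1B u1Z u1L] : [/\ u1 vA = v vLo, u1 vB = z, u1 vZ = z & u1 vLo = v vLo].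
  by [].
have [u1n u1P u1O] : [/\ u1 0 = v 0, u1 vP = v vP & u1 vO = v vO] by [].
rewrite ev_seq; have := mul_spec b1; rewrite u1A u1B.
set y := (v vLo * z) %% _.
set u2 := ev W Mul u1 => M.
have u2E i : i \in [:: 0; vZ; vLo; vP; vO] -> u2 i = u1 i.
  rewrite !inE; do 4!(case/orP; first by move/eqP ->; rewrite /u2 ev_frame).
  by move/eqP ->; rewrite /u2 ev_frame.
rewrite ev_if M u2E // u1n eqn_leq ev_if M u2E // u1n.
case: (leqP y (v 0)) => _ /=; last by rewrite /ev /upd /= !u2E ?u1P ?u1O.
case: (leqP (v 0) y) => _ /=; last by rewrite /ev /upd /= !u2E ?u1P ?u1O.
rewrite ev_if !u2E // u1L u1Z.
case: (leqP (v vLo) z) => _ /=; last by rewrite /ev /upd /= !u2E ?u1P ?u1O.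
rewrite ev_if !u2E // u1n u1Z.
case: (leqP (v 0) z) => _ /=; last by rewrite /ev /upd /= !u2E ?u1P ?u1O.
by rewrite /ev /upd /= !u2E ?u1Z ?u1L.
Qed.

Definition Test : cmd := Sum ;; CLoop Bisect_body ;; Check.

(** Two numbers below n have a product below n * n < 2 ^ W, so the modular product compared with n
    is the true one. *)
Lemma check_sound W v p q : prime p -> prime q -> q < p -> v 0 = p * q ->
  (p * q) * (p * q) < 2 ^ W -> bounded W v ->
  let v' := ev W Check v in
  found p q v' \/ v' vP = v vP /\ v' vO = v vO.
Proof.
move=> pp pq qp vn ltW bv /=; have := checkE bv.
cbv zeta; set z := (v vS + _) %% _; case E: [&& _, _ & _]; last by right.
case=> EP EO.
case/and3P: E => /eqP e le lt; left.
rewrite /found EP EO and_comm.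
rewrite vn in e lt.
have ez : v vLo * z = p * q.
  rewrite -e modn_small //; apply: leq_ltn_trans ltW.
  by rewrite leq_mul // ltnW // (leq_ltn_trans le).
by apply: semiprime_factors => //; rewrite le.
Qed.

(** * The Euclidean algorithm *)

(* [(r1, k1)] and [(r2, k2)] are consecutive remainders with their cofactors;
   the sought pair [(k, d)] is a positive combination of them. *)
Definition between (k d r N r1 k1 r2 k2 : nat) : Prop :=
  exists d1 d2 x y, [/\ k = x * k1 + y * k2, d = x * d1 + y * d2,
    r + y * r2 = x * r1, N = r1 * d2 + r2 * d1 & 0 < x /\ 0 < y].

(** If r2 were 0, then r = x * r1 and N = r1 * d2, whence d * r >= N, against the approximation. No
    division by zero can thus occur before (k, d) is reached. *)
Lemma between_pos k d r N r1 k1 r2 k2 : 3 * d * r < 2 * N ->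
  between k d r N r1 k1 r2 k2 -> 0 < r1 /\ 0 < r2.
Proof.
move=> H [d1 [d2 [x [y [_ Ed Er EN [x0 y0]]]]]].
have r2p : 0 < r2.
  rewrite lt0n; apply/negP => /eqP r20; move: Er EN; rewrite r20 muln0 mul0n !addn0.
  move=> Er EN.
  have : N <= d * r.
    rewrite EN Er Ed mulnDl; apply: leq_trans (leq_addl _ _).
    have -> : y * d2 * (x * r1) = (y * x) * (r1 * d2) by lia.
    by rewrite leq_pmull // muln_gt0 x0 y0.
  lia.
by split=> //; case: r1 Er {EN H} => //; nia.
Qed.

(** The lower step cannot overshoot: x * r1 = r + y * r2 >= y * r2 > y * b * r1, so the coordinate x
    - b * y stays positive. *)
Lemma between_lower k d r N r1 k1 r2 k2 : 0 < r1 -> 0 < r2 ->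
  let b := (r2 - 1) %/ r1 in
  between k d r N r1 k1 r2 k2 ->
  between k d r N r1 k1 ((r2 - 1) %% r1 + 1) (k2 + b * k1).
Proof.
move=> r1p r2p b [d1 [d2 [x [y [Ek Ed Er EN [x0 y0]]]]]].
have : r2 = b * r1 + ((r2 - 1) %% r1 + 1) by rewrite /b; have := divn_eq (r2 - 1) r1; lia.
move: (_ %% _ + 1) (leq_addl ((r2 - 1) %% r1) 1) => c c1 Er2.
have ltx : b * y < x.
  rewrite -(@ltn_pmul2r r1) // -Er Er2; nia.
exists d1, (d2 + b * d1), (x - b * y), y; move: ltx; set x' := x - _ => ltx.
have Ex : x = x' + b * y by rewrite /x'; lia.
split.
- by rewrite Ek Ex; lia.
- by rewrite Ed Ex; lia.
- by move: Er; rewrite Ex Er2; lia.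
- by rewrite EN Er2; lia.
- by split=> //; rewrite /x'; lia.
Qed.

(** Keeps the cofactors within the width W as long as (k, d) lies ahead. *)
Lemma between_leq k d r N r1 k1 r2 k2 :
  between k d r N r1 k1 r2 k2 -> k1 + k2 <= k.
Proof.
by move=> [d1 [d2 [x [y [-> _ _ _ [x0 y0]]]]]]; rewrite leq_add // leq_pmull.
Qed.

(* If the quotient overshoots ([y < a * x]), the approximation hypothesis leaves
   only [a = 2] and [x = y = 1], the single intermediate fraction. *)
Lemma overshoot d r N r1 r2 d1 d2 x y :
  0 < r2 -> 0 < x -> 0 < y -> y < (r1 %/ r2) * x -> 3 * d * r < 2 * N ->
  d = x * d1 + y * d2 -> r + y * r2 = x * r1 -> N = r1 * d2 + r2 * d1 ->
  x = 1 /\ y = 1.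
Proof.
move=> r2p x0 y0; set a := r1 %/ r2; set c := r1 %% r2 => lt H Ed Er EN.
have Er1 : r1 = a * r2 + c by rewrite -divn_eq.
have [g Eg] : exists g, a * x = y + g by exists (a * x - y); lia.
have g0 : 0 < g by lia.
have Er' : r = x * c + g * r2.
  have : r + y * r2 = (a * x) * r2 + x * c by rewrite Er Er1; lia.
  rewrite Eg; lia.
have lt1 : r2 <= r by rewrite Er'; nia.
(* After expanding d and N, the terms in d1 cancel in the right direction because r2 <= r. *)
have H2 : 3 * y * r * d2 < 2 * r1 * d2.
  have : r2 * d1 <= x * d1 * r.
    have -> : x * d1 * r = (x * r) * d1 by lia.
    by rewrite leq_mul2r; apply/orP; right; apply: leq_trans lt1 _; rewrite leq_pmull.
  by move: H; rewrite Ed EN; nia.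
have {}H2 : 3 * y * r < 2 * r1.
  by move: H2; rewrite ltn_mul2r => /andP[].
have H3 : 3 * y * g < 2 * a.
  rewrite -(@ltn_pmul2r r2) // ltnNge; apply/negP => H3.
  by move: H2; rewrite ltnNge => /negP[]; rewrite Er1 Er'; nia.
(* With y + g = a * x this gives 3 * (a * x - 1) < 2 * a. As y and g are positive, a * x >= 2, and
   only x = 1, a = 2 remain, so y = g = 1. A constant larger than 2/3 would spoil this step. *)
have yg : y + g <= y * g + 1 by nia.
have : 3 * (a * x) <= 2 * a + 2 by lia.
nia.
Qed.

(** The cases compare y with a * x. If y is smaller, [overshoot] leaves only the mediant; if they
    are equal, x divides both k and d, so coprimality makes (k, d) the new upper vector; if y is
    larger, both coordinates remain positive. *)
Lemma between_upper k d r N r1 k1 r2 k2 : coprime k d -> 3 * d * r < 2 * N ->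
  between k d r N r1 k1 r2 k2 ->
  let a := r1 %/ r2 in
  [\/ [/\ k = k1 + k2, r = r1 - r2 & r2 <= r1],
      k = k1 + a * k2 /\ r = r1 %% r2 |
      between k d r N (r1 %% r2) (k1 + a * k2) r2 k2].
Proof.
move=> ckd H B a; have [_ r2p] := between_pos H B.
case: B => [d1 [d2 [x [y [Ek Ed Er EN [x0 y0]]]]]].
have Er1 : r1 = a * r2 + r1 %% r2 by rewrite -divn_eq.
case: (ltnP y (a * x)) => le.
  have [ex ey] := overshoot r2p x0 y0 le H Ed Er EN.
  constructor 1; move: Ek Er; rewrite ex ey !mul1n => Ek Er; split; lia.
set y' := y - a * x; have Ey : y = y' + a * x by rewrite /y'; lia.
move: (r1 %% r2) Er1 => c Er1.
have [y'0|y'0] := posnP y'.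
  move: Ey; rewrite y'0 add0n => Ey.
  have x1 : x = 1.
    apply/eqP; rewrite -dvdn1; move: ckd; rewrite /coprime => /eqP <-.
    have dv m n : x %| x * m + a * x * n by apply: dvdn_add; [exact: dvdn_mulr|exact/dvdn_mulr/dvdn_mull].
    by rewrite dvdn_gcd Ek Ed Ey !dv.
  constructor 2; move: Ek Er; rewrite Ey Er1 x1; lia.
constructor 3; exists (d1 + a * d2), d2, x, y'; split=> //.
- by rewrite Ek Ey; lia.
- by rewrite Ed Ey; lia.
- by move: Er; rewrite Ey Er1; lia.
- by rewrite EN Er1; lia.
Qed.

(** * Testing candidates and iterating the rounds *)

(** The loop goes on after a success; a later candidate that is accepted can only write the same
    factors again. *)
Lemma test_sound W v p q : prime p -> prime q -> q < p -> v 0 = p * q ->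
  (p * q) * (p * q) < 2 ^ W -> bounded W v ->
  found p q v -> found p q (ev W Test v).
Proof.
move=> pp pq qp vn ltW bv [fP fO]; rewrite /Test 2!ev_seq.
set w := ev W (CLoop _) _.
have bw : bounded W w by rewrite /w; auto.
have wn : w 0 = p * q by rewrite /w !ev_frame.
have [//|[EP EO]] := check_sound pp pq qp wn ltW bw.
by rewrite /found EP EO /w !ev_frame.
Qed.

Lemma test_complete W v p q R : prime p -> prime q -> q < p -> v 0 = p * q ->
  (p * q) * (p * q) < 2 ^ W -> 2 < W -> bounded W v -> v vOne = 1 ->
  0 < v vTK <= 2 ^ W.-1 -> v vTR + 1 = v vTK * R -> v vTR + 1 < 2 ^ W ->
  v 0 + 1 + R = p + q + v vN -> found p q (ev W Test v).
Proof.
move=> pp pq qp vn ltW W2 bv v1 hk hR lt1 hs.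
have p1 := prime_gt1 pp; have q1 := prime_gt1 pq.
have le_s : p + q + 1 <= p * q by nia.
have lt_s : (p + q) * (p + q) < 2 ^ W by apply: leq_ltn_trans ltW; nia.
have lt_s1 : p + q + 1 < 2 ^ W by apply: leq_ltn_trans ltW; nia.
rewrite /Test 2!ev_seq; set u := ev W Sum v.
have [uS uLo uHi] := sum_spec W2 bv v1 hk hR lt1 hs lt_s1; rewrite -/u in uS uLo uHi.
have bu : bounded W u by rewrite /u; auto.
have u1 : u vOne = 1 by rewrite /u ev_frame.
have un : u 0 = p * q by rewrite /u ev_frame.
have hq : 1 < q < p by rewrite q1.
have L := bisect_spec W2 bu u1 hq un uS lt_s uLo uHi.
set w := ev W (CLoop _) u in L *.
have bw : bounded W w by rewrite /w; auto.
have wS : w vS = p + q by rewrite /w ev_frame.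
have wn : w 0 = p * q by rewrite /w ev_frame.
have := checkE bw; cbv zeta; rewrite L wS wn.
rewrite modn_sub ?addnK; last by rewrite leq_addl /=; lia.
rewrite modn_small; last by rewrite mulnC; apply: leq_ltn_trans ltW; nia.
by rewrite mulnC eqxx ltnW // ltn_Pmulr //; lia.
Qed.

(* Dividing [r2 - 1] instead of [r2] keeps the lower remainder positive. *)
Definition Lower : cmd :=
  CCopy vA vR2 ;; CAdd true vA vOne ;; CCopy vB vR1 ;; Div ;;
  CCopy vR2 vR ;; CAdd false vR2 vOne ;; CCopy vA vQ ;; CCopy vB vK1 ;; Mul ;;
  CAdd false vK2 vQ.

Lemma lower_spec W v : bounded W v -> v vOne = 1 -> 0 < v vR1 <= 2 ^ W.-1 ->
  0 < v vR2 -> v vK2 + (v vR2 - 1) %/ v vR1 * v vK1 < 2 ^ W ->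
  let v' := ev W Lower v in
  v' vR2 = (v vR2 - 1) %% v vR1 + 1 /\
  v' vK2 = v vK2 + (v vR2 - 1) %/ v vR1 * v vK1.
Proof.
move=> bv v1 hr1 r2p ltk; rewrite /Lower 3!ev_seq.
set u1 := ev W (CCopy vB vR1) _.
have b1 : bounded W u1 by rewrite /u1; auto 10.
have [u1A u1B u11] : [/\ u1 vA = v vR2 - 1, u1 vB = v vR1 & u1 vOne = 1].
  by rewrite /u1 /ev /upd /= v1 modn_sub // r2p bv.
have hB : 0 < u1 vB <= 2 ^ W.-1 by rewrite u1B.
have [] := div_spec b1 u11 hB; rewrite u1A u1B ev_seq.
set u2 := ev W Div u1 => Q Rm.
have b2 : bounded W u2 by rewrite /u2; auto.
have u2E i : i \in [:: vOne; vK1; vK2] -> u2 i = v i.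
  by rewrite !inE => /or3P[] /eqP ->; rewrite /u2 ev_frame.
rewrite 4!ev_seq; set u3 := ev W (CCopy vB vK1) _.
have b3 : bounded W u3 by rewrite /u3; auto 10.
have ltr : (v vR2 - 1) %% v vR1 + 1 < 2 ^ W.
  apply: leq_ltn_trans (bv vR2); apply: leq_trans (_ : v vR2 - 1 + 1 <= _).
    by rewrite leq_add2r leq_mod.
  by rewrite subnK.
have [u3A u3B u3R u3K] : [/\ u3 vA = (v vR2 - 1) %/ v vR1, u3 vB = v vK1,
    u3 vR2 = (v vR2 - 1) %% v vR1 + 1 & u3 vK2 = v vK2].
  by rewrite /u3 /ev /upd /= Q Rm !u2E // v1 (modn_small ltr).
rewrite ev_seq; have := mul_spec b3; rewrite u3A u3B modn_small; last first.
  by apply: leq_ltn_trans ltk; apply: leq_addl.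
set u4 := ev W Mul u3 => M.
rewrite /ev /upd /= M; split; first by rewrite /u4 ev_frame.
have -> : u4 vK2 = v vK2 by rewrite /u4 ev_frame.
by rewrite modn_small.
Qed.

Definition Mediant : cmd :=
  CCopy vTK vK1 ;; CAdd false vTK vK2 ;; CCopy vTR vR1 ;; CAdd true vTR vR2.

Definition Reduce : cmd :=
  CCopy vA vR1 ;; CCopy vB vR2 ;; Div ;;
  CCopy vR1 vR ;; CCopy vA vQ ;; CCopy vB vK2 ;; Mul ;; CAdd false vK1 vQ ;;
  CCopy vTK vK1 ;; CCopy vTR vR1.

Definition Upper : cmd := Mediant ;; Test ;; Reduce ;; Test.

Lemma reduce_spec W v : bounded W v -> v vOne = 1 -> 0 < v vR2 <= 2 ^ W.-1 ->
  v vK1 + v vR1 %/ v vR2 * v vK2 < 2 ^ W ->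
  let v' := ev W Reduce v in
  [/\ v' vR1 = v vR1 %% v vR2, v' vTR = v vR1 %% v vR2,
      v' vK1 = v vK1 + v vR1 %/ v vR2 * v vK2 &
      v' vTK = v vK1 + v vR1 %/ v vR2 * v vK2].
Proof.
move=> bv v1 hr2 ltk; rewrite /Reduce 2!ev_seq.
set u1 := ev W (CCopy vB vR2) _.
have b1 : bounded W u1 by rewrite /u1; auto 10.
have [u1A u1B u11] : [/\ u1 vA = v vR1, u1 vB = v vR2 & u1 vOne = 1].
  by rewrite /u1 /ev /upd /=.
have hB : 0 < u1 vB <= 2 ^ W.-1 by rewrite u1B.
have [] := div_spec b1 u11 hB; rewrite u1A u1B ev_seq.
set u2 := ev W Div u1 => Q Rm.
have b2 : bounded W u2 by rewrite /u2; auto.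
have u2E i : i \in [:: vK1; vK2] -> u2 i = v i.
  by rewrite !inE => /orP[] /eqP ->; rewrite /u2 ev_frame.
rewrite 3!ev_seq; set u3 := ev W (CCopy vB vK2) _.
have b3 : bounded W u3 by rewrite /u3; auto 10.
have [u3A u3B u3R u3K] : [/\ u3 vA = v vR1 %/ v vR2, u3 vB = v vK2,
    u3 vR1 = v vR1 %% v vR2 & u3 vK1 = v vK1].
  by rewrite /u3 /ev /upd /= Q Rm !u2E.
rewrite ev_seq; have := mul_spec b3; rewrite u3A u3B modn_small; last first.
  by apply: leq_ltn_trans ltk; apply: leq_addl.
set u4 := ev W Mul u3 => M.
have [u4K u4R] : u4 vK1 = v vK1 /\ u4 vR1 = v vR1 %% v vR2.
  by rewrite /u4 !ev_frame.
by rewrite /ev /upd /= M u4K u4R (modn_small ltk).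
Qed.

(* The quantities of the theorem, with [N = n - x] and [r = k * N - e * d]. *)
Record instance (W p q e d k R N r : nat) : Prop := Instance {
  inst_p : prime p;
  inst_q : prime q;
  inst_qp : q < p;
  inst_N : p * q + 1 + R = p + q + N;
  inst_ed : r + d * e = k * N;
  inst_r : r + 1 = k * R;
  inst_coprime : coprime k d;
  inst_k : 0 < k <= 2 ^ W.-1;
  inst_d : 0 < d;
  inst_approx : 3 * d * r < 2 * N;
  inst_W : 2 < W;
  inst_nW : (p * q) * (p * q) < 2 ^ W;
  inst_NW : N <= 2 ^ W.-1;
  inst_eW : e < 2 ^ W }.

Definition ready (W n N : nat) (v : nat -> nat) : Prop :=
  [/\ bounded W v, v vOne = 1, v 0 = n & v vN = N].

Lemma ready_ev W n N c v : all (fun i => i \notin writes c) [:: vOne; 0; vN] ->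
  ready W n N v -> ready W n N (ev W c v).
Proof.
move=> /= /and4P[h1 h0 hN _] [bv v1 v0 vn].
by split; [apply: bounded_ev|rewrite ev_frame..].
Qed.

Lemma instance_test W p q e d k R N r v : instance W p q e d k R N r ->
  ready W (p * q) N v -> v vTK = k -> v vTR = r -> found p q (ev W Test v).
Proof.
move=> [pp pq qp eN ed er ck kW d0 app W2 nW NW eW] [bv v1 vn vN] vk vr.
apply: (@test_complete _ _ _ _ R) => //; rewrite ?vk ?vr ?vn ?vN //.
have : r + 1 <= N by move: d0 app; case: (d) => // d' _; nia.
have : 2 ^ W.-1 < 2 ^ W by rewrite ltn_exp2l //; lia.
lia.
Qed.

Lemma instance_sound W p q e d k R N r v : instance W p q e d k R N r ->
  ready W (p * q) N v -> found p q v -> found p q (ev W Test v).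
Proof.
move=> [pp pq qp eN ed er ck kW d0 app W2 nW NW eW] [bv v1 vn vN].
exact: test_sound.
Qed.

Lemma ltn_exp2_pred W a : 2 < W -> a <= 2 ^ W.-1 -> a < 2 ^ W.
Proof. by move=> W2 le; apply: leq_ltn_trans le _; rewrite ltn_exp2l //; lia. Qed.

Definition Round : cmd := Lower ;; Upper.

(** The factor 2 ^ i records that the upper remainder halves in every round. It stays positive while
    N < 2 ^ W, so the second alternative cannot survive W rounds. *)
Definition progress (p q d k r N i : nat) (v : nat -> nat) : Prop :=
  found p q v \/ between k d r N (v vR1) (v vK1) (v vR2) (v vK2) /\
                 v vR1 * 2 ^ i <= N.

Lemma round_progress W p q e d k R N r i v : instance W p q e d k R N r ->
  ready W (p * q) N v -> progress p q d k r N i v ->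
  progress p q d k r N i.+1 (ev W Round v).
Proof.
move=> ins rv; rewrite /Round ev_seq; set u := ev W Lower v.
have ru : ready W (p * q) N u by apply: ready_ev.
rewrite /Upper 3!ev_seq.
set u1 := ev W Mediant u; set u2 := ev W Test u1.
set u3 := ev W Reduce u2.
have r1 : ready W (p * q) N u1 by apply: ready_ev.
have r2 : ready W (p * q) N u2 by apply: ready_ev.
have r3 : ready W (p * q) N u3 by apply: ready_ev.
have keep : found p q u2 -> found p q (ev W Test u3).
  move=> [fP fO]; apply: instance_sound ins r3 _.
  by rewrite /found /u3 !ev_frame.
case=> [[fP fO]|[B ltN]].
  left; apply/keep/(instance_sound ins r1).
  by rewrite /found /u1 !ev_frame // /u !ev_frame.
have [W2 app ck kW NW] := And5 (inst_W ins) (inst_approx ins) (inst_coprime ins)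
  (inst_k ins) (inst_NW ins).
have [bv v1 v0 vN] := rv.
have [r1p r2p] := between_pos app B.
have le1N : v vR1 <= N by apply: leq_trans ltN; rewrite leq_pmulr ?expn_gt0.
have hr1 : 0 < v vR1 <= 2 ^ W.-1 by rewrite r1p (leq_trans le1N).
have klt a : a <= k -> a < 2 ^ W.
  by case/andP: kW => _ kW le; apply: ltn_exp2_pred => //; apply: leq_trans kW.
have BL := between_lower r1p r2p B.
have [|EL1 EL2] := lower_spec bv v1 hr1 r2p _.
  by apply: klt; apply: leq_trans (between_leq BL); apply: leq_addl.
rewrite -/u in EL1 EL2; rewrite -EL1 -EL2 in BL.
have [uR1 uK1] : u vR1 = v vR1 /\ u vK1 = v vK1 by rewrite /u !ev_frame.
rewrite -uR1 -uK1 in BL.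
have [ur1p ur2p] := between_pos app BL.
(* Because of this order the upper quotient is at least 1, and the new upper remainder is less than
   half of the old one. *)
have ur2 : u vR2 <= u vR1 by rewrite EL1 uR1 addn1 ltn_mod.
have [bu u11 u0 uN] := ru.
have u2E j : j \in [:: vR1; vK1; vR2; vK2] -> u2 j = u j.
  rewrite !inE; do 3!(case/orP; first by move/eqP ->; rewrite /u2 !ev_frame // /u1 !ev_frame).
  by move/eqP ->; rewrite /u2 !ev_frame // /u1 !ev_frame.
have hr2 : 0 < u2 vR2 <= 2 ^ W.-1.
  by rewrite u2E // ur2p (leq_trans ur2) // uR1 (leq_trans le1N).
have [b2 u21 _ _] := r2.
have [[ek er le]|H|BU] := between_upper ck app BL.
- left; apply: keep; apply: (instance_test ins r1).
    rewrite /u1 /ev /upd /= ek modn_small //; apply: klt; exact: between_leq BL.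
  by rewrite /u1 /ev /upd /= modn_sub ?er // le bu.
- have [|E1 E2 E3 E4] := reduce_spec b2 u21 hr2 _.
    by rewrite !u2E //; apply: klt; case: H => {1}->.
  left; apply: (instance_test ins r3).
    by rewrite /u3 E4 !u2E //; case: H.
  by rewrite /u3 E2 !u2E //; case: H.
- have [|E1 E2 E3 E4] := reduce_spec b2 u21 hr2 _.
    rewrite !u2E //; apply: klt; apply: leq_trans (between_leq BU); exact: leq_addr.
  right; rewrite -/u3 in E1 E3.
  rewrite [ev W Test u3 vR1]ev_frame // [ev W Test u3 vK1]ev_frame //.
  rewrite [ev W Test u3 vR2]ev_frame // [ev W Test u3 vK2]ev_frame //.
  have -> : u3 vR2 = u vR2 by rewrite /u3 ev_frame // u2E.
  have -> : u3 vK2 = u vK2 by rewrite /u3 ev_frame // u2E.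
  rewrite E1 E3 !u2E //; split=> //; apply: leq_trans ltN; rewrite -uR1 expnS mulnA.
  rewrite leq_mul2r; apply/orP; right.
  rewrite {2}(divn_eq (u vR1) (u vR2)).
  have := ltn_pmod (u vR1) ur2p; have : 0 < u vR1 %/ u vR2 by rewrite divn_gt0.
  by move: (_ %/ _) (_ %% _) => a c; nia.
Qed.

(** The vectors (k, d) start as (1, 0) above and (0, 1) below, with remainders N and e. A sign bit 1
    means x < 0, in which case n - x is a sum of natural numbers. The numerals 0 to 3 are
    variables. *)
Definition Init : cmd :=
  CCopy vN 0 ;; CIf vOne 3 (CAdd false vN 2) (CAdd true vN 2) ;;
  CCopy vR1 vN ;; CCopy vK1 vOne ;; CCopy vR2 1.

Definition Main : cmd :=
  Init ;; CLoop Round ;; CCopy 0 vP ;; CCopy 1 vO.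

Lemma main_spec W p q e d k R N r v : instance W p q e d k R N r ->
  bounded W v -> v 0 = p * q -> v 1 = e -> v vOne = 1 -> v vK2 = 0 ->
  v 3 <= 1 -> (if v 3 == 1 then p * q + v 2 = N else p * q = N + v 2) ->
  ev W Main v 0 = p /\ ev W Main v 1 = q.
Proof.
move=> ins bv vn ve v1 vk2 v3 vx; rewrite /Main 3!ev_seq; set u := ev W Init v.
have W2 := inst_W ins; have NW := ltn_exp2_pred W2 (inst_NW ins).
have [uN uR1 uK1 uR2 uK2] : [/\ u vN = N, u vR1 = N, u vK1 = 1, u vR2 = e & u vK2 = 0].
  have [e3|e3] : v 3 = 1 \/ v 3 = 0 by lia.
    rewrite e3 /= in vx.
    by rewrite /u /Init /ev /upd /= v1 e3 /= v1 vn ve vk2 vx modn_small.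
  rewrite e3 /= in vx.
  have hN : (p * q + (2 ^ W - v 2)) %% 2 ^ W = N.
    by rewrite modn_sub; [rewrite vx addnK|rewrite -vn bv vn vx leq_addl].
  by rewrite /u /Init /ev /upd /= v1 e3 /= v1 vn ve vk2 hN.
have ru : ready W (p * q) N u.
  by split; rewrite ?uN //; [apply: bounded_ev|rewrite /u ev_frame..].
rewrite ev_loop; set w := iter _ _ _.
suff [fP fO] : found p q w by rewrite /ev /upd /= fP fO.
have H i : ready W (p * q) N (iter i (ev W Round) u) /\
    progress p q d k r N i (iter i (ev W Round) u).
  elim: i => [|i [IH1 IH2]] /=.
    split=> //; right; rewrite uR1 uK1 uR2 uK2 expn0 muln1; split=> //.
    (* With respect to the starting vectors (1, 0) and (0, 1), the coordinates of (k, d) are k and d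
       themselves. *)
    exists 0, 1, k, d; split; rewrite ?muln0 ?muln1 ?addn0 //.
      exact: inst_ed ins.
    by split; [case/andP: (inst_k ins)|exact: inst_d ins].
  by split; [apply: ready_ev|apply: round_progress ins _ _].
have [_ [//|[B le]]] := H W.
have [r1p _] := between_pos (inst_approx ins) B.
have : 2 ^ W <= N by apply: leq_trans le; rewrite leq_pmull.
by rewrite leqNgt NW.
Qed.

Lemma wf_Main : wf 25 Main.
Proof. by []. Qed.

(** * From the real inequality to natural numbers, and the time bound *)

Import Order.TTheory GRing.Theory Num.Theory.

(** Multiplied by phi, 3 d k R stays below 3 d R (e d) since e d = k phi + 1; this turns the bound
    into 3 d (k R) < 2 phi. It also gives R < phi, so N < 2 n takes one digit more than n, while d <
    phi gives k < e. The square of n needs twice the digits of n, which W amply provides. *)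
Lemma instanceI p q e d k R W : prime p -> prime q -> q < p -> 0 < d ->
  d < p.-1 * q.-1 -> e * d = k * (p.-1 * q.-1) + 1 -> 0 < k -> 0 < R ->
  3 * (d * d * (e * R)) < 2 * ((p.-1 * q.-1) * (p.-1 * q.-1)) ->
  W = 4 * (size (bits (p * q)) + size (bits e)) + 8 ->
  instance W p q e d k R (p.-1 * q.-1 + R) (k * R - 1) /\ R < p * q.
Proof.
move=> pp pq qp d0 dphi ed k0 R0 app eW.
have p1 := prime_gt1 pp; have q1 := prime_gt1 pq.
have epq : p * q + 1 = p + q + p.-1 * q.-1.
  have -> : p = p.-1.+1 by lia.
  have -> : q = q.-1.+1 by lia.
  by rewrite /=; lia.
move: (p.-1 * q.-1) dphi ed app epq => phi dphi ed app epq.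
have kR0 : 0 < k * R by rewrite muln_gt0 k0.
have lt3 : 3 * d * (k * R) < 2 * phi.
  have phi0 : 0 < phi by lia.
  rewrite -(@ltn_pmul2r phi) //.
  have -> : 2 * phi * phi = 2 * (phi * phi) by lia.
  apply: leq_ltn_trans app.
  have -> : 3 * (d * d * (e * R)) = 3 * d * R * (e * d) by lia.
  by rewrite ed; nia.
have Rphi : R < phi by move: lt3; case: (d) d0 => // d' _; case: (k) k0 => // k' _; nia.
have ke : k < e.
  have phi0 : 0 < phi by lia.
  rewrite -(@ltn_pmul2r phi) //; apply: leq_trans (_ : e * d <= _); first by lia.
  by rewrite leq_mul2l ltnW ?orbT.
have nlt := lt_size_bits (p * q); have elt := lt_size_bits e.
have leW a : a <= W -> 2 ^ a <= 2 ^ W by move=> ?; rewrite leq_exp2l.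
have leW1 a : a < W -> 2 ^ a <= 2 ^ W.-1 by move=> ?; rewrite leq_exp2l //; lia.
split; last by lia.
split=> //.
- by lia.
- by rewrite mulnDr; lia.
- by lia.
- rewrite /coprime -dvdn1 -(dvdn_addr _ (dvdn_mulr phi (dvdn_gcdl k d))) -ed.
  exact/dvdn_mull/dvdn_gcdr.
- rewrite k0 /=; apply: leq_trans (_ : 2 ^ size (bits e) <= _).
    by apply: ltnW; apply: ltn_trans elt.
  by apply: leW1; lia.
- by rewrite mulnBr mulnDr muln1; lia.
- by lia.
- apply: (@leq_trans (2 ^ size (bits (p * q)) * 2 ^ size (bits (p * q)))).
    by rewrite ltn_mul.
  by rewrite -expnD; apply: leW; lia.
- apply: (@leq_trans (2 ^ (size (bits (p * q))).+1)).
    by rewrite expnS; lia.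
  by apply: leW1; lia.
- by apply: leq_trans elt _; apply: leW; lia.
Qed.

Local Open Scope ring_scope.

(** The subtracted root of 3 n pays for replacing n by phi = n - (p + q - 1): the root of 2/3 times
    p + q - 1 is at most the root of 3 n. Squaring then removes all roots. *)
Lemma approx_nat (K : realType) (p q e d R : nat) :
  prime p -> prime q -> (q < p < 2 * q)%N -> (0 < e)%N -> (0 < d)%N -> (0 < R)%N ->
  d%:R < (Num.sqrt (2 / 3) * (p * q)%N%:R - Num.sqrt (3 * (p * q)%N%:R))
             * (e%:R * R%:R) `^ (- (1 / 2)) :> K ->
  (3 * (d * d * (e * R)) < 2 * ((p.-1 * q.-1) * (p.-1 * q.-1)))%N.
Proof.
move=> pp pq /andP[qp p2q] e0 d0 R0.
have p1 := prime_gt1 pp; have q1 := prime_gt1 pq.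
rewrite -(natrM K e R); set a : K := (e * R)%N%:R; set c := _ - _.
have a0 : 0 < a by rewrite ltr0n muln_gt0 e0.
rewrite powRN div1r powR12_sqrt ?ltW // ltr_pdivlMr ?sqrtr_gt0 // => H.
pose phi : K := (p.-1 * q.-1)%N%:R.
have phi0 : 0 <= phi by rewrite ler0n.
have le_c : c <= Num.sqrt (2 / 3) * phi.
  rewrite /c lerBlDr -lerBlDl -mulrBr.
  have -> : (p * q)%N%:R - phi = (p + q).-1%:R.
    have -> : (p * q = p.-1 * q.-1 + (p + q).-1)%N.
      have -> : p = p.-1.+1 by lia.
      have -> : q = q.-1.+1 by lia.
      by rewrite /=; lia.
    by rewrite natrD addrAC subrr add0r.
  rewrite -[X in _ * X]ger0_norm ?ler0n // -sqrtr_sqr -sqrtrM ?divr_ge0 //.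
  apply: ler_wsqrtr.
  (* The difference 2 (p + q)^2 - 9 p q equals (2 p - q) (p - 2 q), negative for q < p < 2 q. *)
  have : ((p + q).-1 * (p + q).-1 * 2 <= 9 * (p * q))%N by nia.
  by rewrite -(ler_nat K) !natrM => h; lra.
have : d%:R * Num.sqrt a < Num.sqrt (2 / 3) * phi by apply: lt_le_trans le_c.
have s0 : 0 <= d%:R * Num.sqrt a by rewrite mulr_ge0 ?sqrtr_ge0.
rewrite -(@ltr_pXn2r _ 2) ?nnegrE ?mulr_ge0 ?sqrtr_ge0 // !exprMn !sqr_sqrtr ?ltW //.
rewrite /phi /a => h; rewrite -(ltr_nat K) !natrM; rewrite !natrM in h; lra.
Qed.

Lemma up_log_ln (K : realType) (n : nat) : (0 < n)%N ->
  (up_log 2 n.+1)%:R <= 2 * ln n%:R + 1 :> K.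
Proof.
move=> n0; have n1 : (1 < n.+1)%N by [].
have := up_log_gtn (isT : 1 < 2)%N n1; have := up_log_gt0 2 n.+1; rewrite n1 /=.
case: (up_log _ _) => // l _; rewrite ltnS /= -(ler_nat K) natrX => le.
have : ln (2 ^+ l) <= ln n%:R :> K by rewrite ler_ln ?posrE ?exprn_gt0 ?ltr0n.
rewrite lnXn // -[ln 2 *+ l]mulr_natr.
(* This is ln (1 + t) <= t at t = - 1/2. *)
have ln2 : 1 / 2 <= ln 2 :> K.
  have := @le_ln1Dx K (- (1 / 2)) _; have -> : 1 + - (1 / 2) = 2^-1 :> K by lra.
  by rewrite lnV ?posrE // => /(_ _) h; have := h ltac:(lra); lra.
have : (1 / 2) * l%:R <= ln 2 * l%:R :> K by rewrite ler_wpM2r.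
by rewrite -(natr1 l) => h1 h2; lra.
Qed.

Theorem theorem3p1 (K : realType) :
  exists (A : program) (T : {poly K}),
    forall (p q n e d : nat) (x R : int),
      prime p -> prime q -> (q < p < 2 * q)%N -> n = (p * q)%N ->
      (1 < e)%N -> coprime e (totient n) ->
      (1 <= d < totient n)%N -> (e * d = 1 %[mod totient n])%N ->
      p%:Z + q%:Z - 1 = x + R -> 0 < R ->
      d%:R < (Num.sqrt (2 / 3) * n%:R - Num.sqrt (3 * n%:R))
             * (e%:R * R%:~R) `^ (- (1 / 2)) :> K ->
      exists (t : nat) (s : store),
        [/\ halts_with A (input n e x) t s,
            s 0%N = bits p, s 1%N = bits q
          & t%:R <= T.[ln (e * n)%:R]].
Proof.
have [C [D costP]] := cost_poly Main.
exists (full_program 25 Main).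
(* The linear factor bounds W + 1 = 4 (a + b) + 9, where the digit counts a, b of n and e are at
   most 2 ln n + 1 and 2 ln e + 1. The 1000 absorbs setup and output, which take 25 (24 W + 11) + 44
   W + 60 steps; the exponent [D.+1] covers this linear term even for D = 0. *)
exists ((C + 1000)%:R *: (8%:R *: 'X + 17%:R%:P) ^+ D.+1).
move=> p q n e d x R pp pq qpq en e1 _ /andP[d0 dphi] ed exR R0 hd.
have /andP[qp p2q] := qpq.
have p1 := prime_gt1 pp; have q1 := prime_gt1 pq.
have etot : totient n = (p.-1 * q.-1)%N.
  rewrite en totient_coprime ?totient_prime //.
  by rewrite prime_coprime // dvdn_prime2 // neq_ltn qp orbT.
rewrite etot in dphi ed.
case: R exR R0 hd => // R exR R0 hd; rewrite ltz_nat in R0.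
have phi1 : (1 < p.-1 * q.-1)%N by apply: leq_trans dphi.
set phi := (p.-1 * q.-1)%N in dphi ed phi1.
have ed' : (e * d = (e * d) %/ phi * phi + 1)%N.
  by rewrite {1}(divn_eq (e * d) phi) ed modn_small.
have k0 : (0 < (e * d) %/ phi)%N.
  by rewrite lt0n; apply/negP => /eqP k0; move: ed'; rewrite k0; nia.
have app : (3 * (d * d * (e * R)) < 2 * (phi * phi))%N.
  by apply: (approx_nat pp pq qpq (ltnW e1) d0 R0 _); rewrite -en; exact: hd.
pose W := (4 * (size (bits n) + size (bits e)) + 8)%N.
have eW : W = (4 * (size (bits (p * q)) + size (bits e)) + 8)%N by rewrite /W en.
have [ins Rn] := instanceI pp pq qp d0 dphi ed' k0 R0 app eW.
have epq : (p * q + 1 = p + q + phi)%N by have := inst_N ins; rewrite -/phi; lia.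
(* As x = p + q - 1 - R with 0 < R < n, the third input fits into W digits although W is computed
   from n and e only. *)
have xle : (`|x| <= n)%N by lia.
have szs i : (size (input n e x i) <= W)%N.
  have le1 : (size (bits n) <= W)%N by rewrite /W; lia.
  case: i => [|[|[|[|i]]]] //.
  - by rewrite /W /=; lia.
  - by apply: leq_trans le1; apply: size_bits_leq; apply: leq_ltn_trans xle (lt_size_bits n).
  - by rewrite /W /=; lia.
have fin : free_from 4 (input n e x) by case=> [|[|[|[|i]]]].
have [v [s [bv vE [t let_ Ht] s0 s1]]] :=
  @full_program_runs 25 Main (input n e x) W isT wf_Main fin erefl szs.
have [m0 m1] : ev W Main v 0%N = p /\ ev W Main v 1%N = q.
  apply: (main_spec ins bv); rewrite ?vE //= ?bval_bits //.
  - by case: (x < 0).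
  - rewrite -/phi; case: ltP => hx /=; lia.
exists t, s; split; [exact: (Ht [::])|by rewrite s0 m0|by rewrite s1 m1|].
apply: (@le_trans _ _ ((C + 1000) * W.+1 ^ D.+1)%N%:R).
  rewrite ler_nat; apply: leq_trans let_ _; rewrite mulnDl; apply: leq_add.
    by apply: leq_trans (costP W) _; rewrite leq_mul2l leq_pexp2l ?leqnSn ?orbT.
  apply: leq_trans (_ : 1000 * W.+1 <= _)%N; first by lia.
  by rewrite leq_mul2l expnS leq_pmulr ?expn_gt0.
have n0 : (0 < n)%N by rewrite en muln_gt0 !prime_gt0.
rewrite hornerZ horner_exp hornerD hornerZ hornerX hornerC natrM natrX.
rewrite ler_wpM2l ?ler0n // lerXn2r ?nnegrE ?ler0n //.
  by rewrite addr_ge0 ?mulr_ge0 ?ler0n // ln_ge0 // ler1n muln_gt0 n0 ltnW.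
rewrite -(natr1 W) /W !size_bits natrM lnM ?posrE ?ltr0n ?(ltnW e1) //.
have := up_log_ln K n0; have := up_log_ln K (ltnW e1).
move: (up_log 2 n.+1) (up_log 2 e.+1) => a b; rewrite natrD natrM natrD; lra.
Qed.
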